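(* If $G$ is a subdivision of a $3$-connected plane graph $R$, then $$\chi_c(G) \leq \Big\lfloor \tfrac32 \max_{f\in F(G)}\{ \deg_G(f) -\deg_R(f')\}\Big\rfloor + \chi_c(R),$$ where for each face $f$ of $G$, $f'$ is the face of $R$ corresponding to $f$. Moreover, the bound is tight: there exist such graphs for which equality holds.
   Context: Plane graphs may have multiple edges but no loops. A subdivision of a graph is obtained by repeatedly replacing an edge $uv$ by a path $u,w,v$ through a new vertex $w$; the faces of $G$ are in natural one-to-one correspondence with the faces of $R$. $F(G)$ is the face set of $G$, and $\deg_G(f)$ is the number of vertices incident with the face $f$ in $G$. A cyclic coloring of a plane graph is a vertex coloring in which any two distinct vertices incident with a common face receive distinct colors; $\chi_c$ denotes the minimum number of colors in a cyclic coloring. *)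

(* Defs.v *)
From HB Require Import structures.
From mathcomp Require Import all_boot all_order all_algebra finmap.
From mathcomp Require Import all_classical all_reals topology normedtype.
Set Implicit Arguments.
Unset Strict Implicit.
Unset Printing Implicit Defensive.
Import Order.TTheory GRing.Theory Num.Theory.
Import numFieldNormedType.Exports.
Local Open Scope classical_set_scope.
Local Open Scope ring_scope.

Notation plane R := (R * R)%type.

(* A is a Jordan arc with ends x and y; they are distinct by injectivity. *)
Definition jordan_arc (R : realType) (A : set (plane R)) (x y : plane R) : Prop :=
  exists g : R -> plane R,
    [/\ {within `[0, 1], continuous g},
        {in `[0, 1] &, injective g},
        g 0 = x, g 1 = y & g @` `[0, 1] = A].

(* A plane multigraph without loops: finitely many points, and finitely many
   arcs (as point sets, closed at their ends) between two of these points; the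
   interior of an arc contains no vertex and no point of another arc. Parallel
   edges are distinct arcs with the same ends. *)
Record plane_graph (R : realType) := PlaneGraph {
  vertices : {fset plane R};
  edges : set (set (plane R));
  edges_finite : finite_set edges;
  edges_arc : forall e, edges e -> exists x y,
    jordan_arc e x y /\ e `&` [set` vertices] = [set x; y];
  edges_disjoint : forall e e', edges e -> edges e' -> e <> e' ->
    e `&` e' `<=` [set` vertices]
}.

Section PlaneGraph.
Variable R : realType.
Implicit Types (G H : plane_graph R) (e f : set (plane R)) (v w : plane R).

Definition drawing G : set (plane R) :=
  [set` vertices G] `|` \bigcup_(e in edges G) e.

Definition faces G : set (set (plane R)) :=
  connected_component (~` drawing G) @` (~` drawing G).

(* A vertex never lies in a face, so for a face f this says that v lies on the
   boundary of f. *)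
Definition incident v f : Prop := closure f v.

Definition face_deg G f : nat :=
  #|` [fset v in vertices G | `[< incident v f >]]%fset|.

Definition adjacent G v w : Prop :=
  v <> w /\ exists2 e, edges G e & e v /\ e w.

(* G - X is connected *)
Definition connected_minus G (X : {fset plane R}) : Prop :=
  forall v w : vertices G, val v \notin X -> val w \notin X ->
    connect [rel a b : vertices G |
      [&& val a \notin X, val b \notin X & `[< adjacent G (val a) (val b) >]]]
      v w.

Definition k_connected (k : nat) G : Prop :=
  (k < #|` vertices G|)%N /\
  forall X : {fset plane R}, (X `<=` vertices G)%fset -> (#|` X| < k)%N ->
    connected_minus G X.

Definition cyclic_coloring G (C : Type) (c : vertices G -> C) : Prop :=
  forall f, faces G f -> forall v w : vertices G, v <> w ->
    incident (val v) f -> incident (val w) f -> c v <> c w.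

Definition cyclic_colorable G (k : nat) : Prop :=
  exists c : vertices G -> 'I_k, cyclic_coloring c.

Lemma cyclic_colorable_ex G : exists k, `[< cyclic_colorable G k >].
Proof.
exists #|{: vertices G}|; apply/asboolP; exists enum_rank.
by move=> f _ v w vw _ _ /enum_rank_inj.
Qed.

Definition chi_c G : nat := ex_minn (cyclic_colorable_ex G).

(* H arises from G by replacing the edge e, with ends u and v, by the path
   u, w, v, drawn along e. *)
Definition subdivides_once G H : Prop :=
  exists e u v w e1 e2,
    [/\ edges G e /\ w \notin vertices G,
        jordan_arc e u v,
        [/\ jordan_arc e1 u w, jordan_arc e2 w v, e1 `|` e2 = e & e1 `&` e2 = [set w]],
        vertices H = (w |` vertices G)%fset &
        edges H = (edges G `\ e) `|` [set e1; e2]].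

Inductive subdivision G : plane_graph R -> Prop :=
| subdivision_refl : subdivision G G
| subdivision_step H H' :
    subdivision G H -> subdivides_once H H' -> subdivision G H'.

Lemma subdivides_once_drawing G H :
  subdivides_once G H -> drawing H = drawing G.
Proof.
move=> [e [u [v [w [e1 [e2 [[Ge _] _ [_ [g [_ _ gw _ ge2]] e12 _] VH EH]]]]]]].
rewrite /drawing VH EH; apply/seteqP; split => x.
- case=> [/=|[e' [[Ge' _]|[->|->]] e'x]].
  + rewrite in_fset1U => /orP[/eqP->|xG]; last by left.
    right; exists e => //; rewrite -e12; right; rewrite -ge2; exists 0 => //=.
    by rewrite in_itv /= lexx ler01.
  + by right; exists e'.
  + by right; exists e => //; rewrite -e12; left.
  + by right; exists e => //; rewrite -e12; right.
- case=> [/= xG|[e' Ge' e'x]]; first by left; rewrite /= in_fset1U xG orbT.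
  have [ee'|ee'] := pselect (e' = e).
    move: e'x; rewrite ee' -e12 => -[ex|ex]; right.
      by exists e1 => //; right; left.
    by exists e2 => //; right; right.
  by right; exists e' => //; left.
Qed.

(* As new vertices are placed on the old edges, corresponding faces of a
   plane graph and of its subdivision are the same subset of the plane. *)
Lemma subdivision_faces G H : subdivision G H -> faces H = faces G.
Proof.
by elim=> // H1 H2 _ <- /subdivides_once_drawing; rewrite /faces => ->.
Qed.

(* the maximum of A, if it exists *)
Definition nat_max (A : set nat) : nat :=
  xget 0%N [set m | A m /\ forall n, A n -> (n <= m)%N].

(* Maximum over the faces f of G, a subdivision of H, of deg_G f - deg_H f
   (with deg_H f <= deg_G f, so that the subtraction is not truncated); see
   subdivision_faces for f as a face of H. *)
Definition max_excess H G : nat :=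
  nat_max [set (face_deg G f - face_deg H f)%N | f in faces G].

End PlaneGraph.

(* Main.v *)
Require Import Defs.
From mathcomp Require Import all_boot all_order all_algebra finmap.
From mathcomp Require Import all_classical all_reals topology normedtype numfun.
From mathcomp Require Import ring lra zify.
Set Implicit Arguments.
Unset Strict Implicit.
Unset Printing Implicit Defensive.
Import Order.TTheory GRing.Theory Num.Theory.
Import numFieldNormedType.Exports.

(** Two subdivision vertices conflict when they lie on a common face, and each
    subdivision vertex lies on at most two faces.  So the subdivision vertices are
    the edges of a multigraph on the faces, of maximum degree [max_excess H G], and
    Shannon's theorem colors them with [(3 * max_excess H G) %/ 2] colors; the
    vertices of [H] keep the colors of an optimal coloring of [H].

    For arbitrary Jordan arcs, that a point [w] inside an edge [e] meets at most two
    faces is proved with angle functions, as in Eilenberg's criterion.  Take points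
    [p1], [p2], [p3] of three faces close to [w].  The angles of [z - pi] lift to
    real functions along [e], and their differences lift on the rest of the drawing,
    from which the [pi] cannot be told apart.  These lifts disagree at the ends of
    [e] by integers, so some nontrivial integer combination of the three angles,
    with coefficients of sum zero, lifts on the whole drawing.  By Tietze's theorem
    the lift extends to the plane, and a winding number computation around a bounded
    face shows that the coefficient of each bounded face among the three is zero.

    The bound is attained by the plane drawing of K4 whose three inner edges are
    subdivided [uphalf k], [k./2] and [k./2] times: any two vertices then share one
    of the three inner faces. *)

(** * Edge colorings of multigraphs *)

Section Shannon.
Import mathcomp.boot.fintype mathcomp.boot.finset.
Variables (E : finType) (V : eqType) (a b : E -> V).
Hypothesis ab : forall e, a e != b e.
Implicit Types (e : E) (v : V).

Definition ends e v := (a e == v) || (b e == v).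
Definition opposite e v := if a e == v then b e else a e.
Definition proper_coloring n (D : {set E}) (c : E -> 'I_n) :=
  forall e e' v, e \in D -> e' \in D -> e != e' -> ends e v -> ends e' v ->
    c e != c e'.

Lemma oppositeK e v : ends e v -> opposite e (opposite e v) = v.
Proof.
rewrite /ends /opposite; case: (eqVneq (a e) v) => [<- _|_ /= /eqP<-].
  by rewrite (negbTE (ab e)).
by rewrite eqxx.
Qed.

Lemma ends_opposite e v : ends e v -> ends e (opposite e v).
Proof. by rewrite /ends /opposite; case: ifP => _ _; rewrite eqxx ?orbT. Qed.

Lemma endsP e u v : ends e u -> u != v -> ends e v -> v = opposite e u.
Proof.
rewrite /ends /opposite; case: (eqVneq (a e) u) => [->|_ /= /eqP->].
  by move=> _ /negbTE -> /= /eqP.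
by move=> /negbTE->; rewrite orbF => /eqP.
Qed.

Section Kempe.
Variables (n : nat) (D : {set E}) (c : E -> 'I_n).
Hypothesis cD : proper_coloring D c.
Implicit Types beta gamma : 'I_n.

Definition missing v beta := [forall e in D, ends e v ==> (c e != beta)].

Lemma missingP v beta :
  reflect (forall e, e \in D -> ends e v -> c e != beta) (missing v beta).
Proof.
apply: (iffP forall_inP) => [H e eD /(implyP (H e eD))//|H e eD].
by apply/implyP; exact: H.
Qed.

Definition across beta v :=
  if [pick e in D | ends e v && (c e == beta)] is Some e then opposite e v else v.

Lemma across_edge beta v e : e \in D -> ends e v -> c e = beta ->
  across beta v = opposite e v.
Proof.
move=> eD ev ce; rewrite /across; case: pickP => [e' /and3P[e'D e'v /eqP ce']|].
  have [->//|ee'] := eqVneq e' e.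
  by have := cD e'D eD ee' e'v ev; rewrite ce ce' eqxx.
by move=> /(_ e); rewrite eD ev ce eqxx.
Qed.

Lemma across_missing beta v : missing v beta -> across beta v = v.
Proof.
move=> /missingP m; rewrite /across; case: pickP => // e /and3P[eD ev /eqP ce].
by have := m _ eD ev; rewrite ce eqxx.
Qed.

Lemma acrossK beta : involutive (across beta).
Proof.
move=> v; rewrite {2}/across; case: pickP => [e /and3P[eD ev /eqP ce]|].
  by rewrite (across_edge (e := e)) ?ends_opposite ?oppositeK.
move=> H; apply/across_missing/missingP => e eD ev; apply/eqP => ce.
by have := H e; rewrite eD ev ce eqxx.
Qed.

Variables (beta gamma : 'I_n).

(* The Kempe chain of [y]: it leaves [y] along the color gamma, since beta is
   missing at [y], and stays put at a vertex where the next color is missing. *)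
Fixpoint walk y i :=
  if i is j.+1 then across (if odd j then beta else gamma) (walk y j) else y.

Lemma walk_neighbor y j : missing y beta ->
  across beta (walk y j) = (if odd j then walk y j.+1 else walk y j.-1) /\
  across gamma (walk y j) = (if odd j then walk y j.-1 else walk y j.+1).
Proof.
move=> my; case: j => [|j] /=; first by rewrite across_missing.
by case: (odd j) => /=; rewrite acrossK.
Qed.


(* Once the walk stays put at a vertex it goes back to [y], so it never gets past
   the first such vertex. *)
Lemma walk_missing_unique y i j : missing y beta ->
  missing (walk y i) gamma -> missing (walk y j) gamma -> walk y i = walk y j.
Proof.
move=> my.
have even_idx l : missing (walk y l) gamma ->
    exists2 l', ~~ odd l' & walk y l' = walk y l.
  case: (boolP (odd l)) => ol ml; last by exists l.
  exists l.-1; first by case: l ol {ml}.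
  by have [_] := walk_neighbor l my; rewrite ol across_missing.
wlog exP : / exists l, ~~ odd l && missing (walk y l) gamma.
  move=> H mi mj; apply: H => //; have [l ol wl] := even_idx _ mi.
  by exists l; rewrite ol wl.
have [m /andP[om mm] minm] := ex_minnP exP.
have small l : exists2 l', (l' <= m)%N & walk y l = walk y l'.
  elim: l => [|l [l' l'm IH]]; first by exists 0.
  rewrite /= IH; have [nb ng] := walk_neighbor l' my.
  have [->|l'nm] := eqVneq l' m.
    case: (odd l); last by exists m => //; rewrite across_missing.
    have [-> _] := walk_neighbor m my; rewrite (negbTE om).
    by exists m.-1; rewrite ?leq_pred.
  case: (odd l); rewrite ?nb ?ng; case: (odd l').
  - by exists l'.+1 => //; lia.
  - by exists l'.-1 => //; lia.
  - by exists l'.-1 => //; lia.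
  - by exists l'.+1 => //; lia.
have uniq l : missing (walk y l) gamma -> walk y l = walk y m.
  have [l' l'm ->] := small l => ml'.
  have [ol'|ol'] := boolP (odd l'); last first.
    by congr walk; apply/eqP; rewrite eqn_leq l'm minm // ol'.
  have := minm l'.-1; have [_] := walk_neighbor l' my.
  rewrite ol' across_missing // => <-.
  have -> : ~~ odd l'.-1 by case: (l') ol'.
  by move=> /(_ ml'); lia.
by move=> /uniq-> /uniq->.
Qed.

Definition transpose delta :=
  if delta == beta then gamma else if delta == gamma then beta else delta.

Lemma transposeK : involutive transpose.
Proof.
move=> d; rewrite /transpose; case: (eqVneq d beta) => [->|db].
  by rewrite eqxx; case: eqVneq => // ->.
case: (eqVneq d gamma) => [->|dg]; first by rewrite eqxx.
by rewrite (negbTE db) (negbTE dg).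
Qed.

Definition kempe_swap y e :=
  if `[< exists i, walk y i = a e >] then transpose (c e) else c e.

Lemma kempe_swapE y e v : missing y beta -> e \in D -> ends e v ->
  kempe_swap y e = if `[< exists i, walk y i = v >] then transpose (c e) else c e.
Proof.
move=> my eD ev; rewrite /kempe_swap.
have [cb|cb] := boolP ((c e == beta) || (c e == gamma)); last first.
  by move: cb; rewrite /transpose; do 2![case: eqP => //]; rewrite !if_same.
suff H u : ends e u -> (exists i, walk y i = u) ->
    exists i, walk y i = opposite e u.
  have [<-//|av] := eqVneq (a e) v.
  have ea : ends e (a e) by rewrite /ends eqxx.
  have -> : a e = opposite e v by apply: (endsP ev) => //; rewrite eq_sym.
  have -> // : `[< exists i, walk y i = opposite e v >] =
               `[< exists i, walk y i = v >].
  apply: asbool_equiv_eq; split; last exact: H.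
  by move=> /H; rewrite ends_opposite // oppositeK //; exact.
move=> eu [i wi].
have [wb wg] := walk_neighbor i my; rewrite wi in wb wg.
case/orP: cb => /eqP ce.
  by rewrite -(across_edge eD eu ce) wb; case: (odd i); eexists.
by rewrite -(across_edge eD eu ce) wg; case: (odd i); eexists.
Qed.

Lemma kempe_swap_proper y : missing y beta -> proper_coloring D (kempe_swap y).
Proof.
move=> my e e' v eD e'D ee' ev e'v.
rewrite (kempe_swapE my eD ev) (kempe_swapE my e'D e'v).
have := cD eD e'D ee' ev e'v; case: ifP => // _.
by apply: contra_neq => /(congr1 transpose); rewrite !transposeK.
Qed.
End Kempe.

Section Swap.
Variables (n : nat) (D : {set E}) (c : E -> 'I_n) (beta gamma : 'I_n) (y : V).
Hypotheses (cD : proper_coloring D c) (my : missing D c y beta).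
Let c' := kempe_swap D c beta gamma y.

Lemma kempe_swap_missing_in v delta : (exists i, walk D c beta gamma y i = v) ->
  missing D c v delta -> missing D c' v (transpose beta gamma delta).
Proof.
move=> yv /missingP mv; apply/missingP => e eD ev.
rewrite /c' (kempe_swapE cD gamma my eD ev) asboolT //.
apply: contra_neq (mv e eD ev) => /(congr1 (transpose beta gamma)).
by rewrite !transposeK.
Qed.

Lemma kempe_swap_missing_notin v delta :
  ~ (exists i, walk D c beta gamma y i = v) ->
  missing D c v delta -> missing D c' v delta.
Proof.
move=> yv /missingP mv; apply/missingP => e eD ev.
by rewrite /c' (kempe_swapE cD gamma my eD ev) asboolF // mv.
Qed.
End Swap.

Definition recolor n (c : E -> 'I_n) e gamma e' := if e' == e then gamma else c e'.

Lemma recolor_proper n (D : {set E}) (c : E -> 'I_n) e gamma :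
  proper_coloring (D :\ e) c -> missing (D :\ e) c (a e) gamma ->
  missing (D :\ e) c (b e) gamma -> proper_coloring (e |: D) (recolor c e gamma).
Proof.
move=> cD /missingP ma /missingP mb.
have m e' v : e' \in D :\ e -> ends e v -> ends e' v -> c e' != gamma.
  by move=> e'D /orP[] /eqP<-; [exact: ma|exact: mb].
move=> e1 e2 v; rewrite /recolor !in_setU1.
case: (eqVneq e1 e) => [->|e1e]; case: (eqVneq e2 e) => [->|e2e] //=.
- by move=> _ e2D _ ev e2v; rewrite eq_sym (m _ v) // !inE e2e.
- by move=> e1D _ _ e1v ev; rewrite (m _ v) // !inE e1e.
- by move=> e1D e2D; apply: cD; rewrite !inE ?e1e ?e2e.
Qed.

Lemma missingS n (D D' : {set E}) (c : E -> 'I_n) v gamma :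
  D' \subset D -> missing D c v gamma -> missing D' c v gamma.
Proof.
move=> /subsetP sD /missingP m; apply/missingP => e /sD; exact: m.
Qed.

Lemma properS n (D D' : {set E}) (c : E -> 'I_n) :
  D' \subset D -> proper_coloring D c -> proper_coloring D' c.
Proof. by move=> /subsetP sD p e e' v /sD ? /sD ?; exact: p. Qed.

Lemma color_common n (D : {set E}) (c : E -> 'I_n) e gamma : proper_coloring D c ->
  missing D c (a e) gamma -> missing D c (b e) gamma ->
  exists c' : E -> 'I_n, proper_coloring (e |: D) c'.
Proof.
move=> cD ma mb; exists (recolor c e gamma); apply: recolor_proper.
- exact: properS (subD1set _ _) cD.
- exact: missingS (subD1set _ _) ma.
- exact: missingS (subD1set _ _) mb.
Qed.

Lemma color_shift n (D : {set E}) (c : E -> 'I_n) e e1 gamma : proper_coloring D c ->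
  e1 \in D -> ends e1 (b e) -> missing D c (a e) (c e1) ->
  missing D c (b e) gamma -> missing D c (opposite e1 (b e)) gamma ->
  exists c' : E -> 'I_n, proper_coloring (e |: D) c'.
Proof.
move=> cD e1D e1b ma mb mz.
have D1 : e1 |: D = D by apply/setUidPr; rewrite sub1set.
have m1 v : ends e1 v -> missing D c v gamma.
  by move=> e1v; have [<-//|bv] := eqVneq (b e) v; rewrite (endsP e1b bv e1v).
apply: (@color_common _ _ (recolor c e1 gamma) e (c e1)).
- rewrite -D1; apply: recolor_proper; first exact: properS (subD1set _ _) cD.
  + by apply: (missingS (subD1set _ _)); apply: m1; rewrite /ends eqxx.
  + by apply: (missingS (subD1set _ _)); apply: m1; rewrite /ends eqxx orbT.
- apply/missingP => e2 e2D e2a; rewrite /recolor; case: (e2 =P e1) => [e21|_].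
    by have /missingP/(_ _ e2D e2a) := ma; rewrite e21 eqxx.
  by have /missingP/(_ _ e2D e2a) := ma.
- apply/missingP => e2 e2D e2b; rewrite /recolor; case: (e2 =P e1) => [e21|/eqP e21].
    by have /missingP/(_ _ e1D e1b) := mb; rewrite eq_sym.
  exact: (cD _ _ _ e2D e1D e21 e2b e1b).
Qed.

Lemma card_missing n (D : {set E}) (c : E -> 'I_n) v :
  n <= #|[set g | missing D c v g]| + #|[set e in D | ends e v]|.
Proof.
rewrite -{1}(card_ord n) -(cardsC [set g | missing D c v g]) leq_add2l.
apply: leq_trans (leq_imset_card c _); apply/subset_leq_card/subsetP => g.
rewrite !inE => /forall_inPn[e eD]; rewrite negb_imply negbK => /andP[ev /eqP<-].
by apply: imset_f; rewrite inE eD.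
Qed.

Theorem shannon k : (forall v, #|[set e | ends e v]| <= k) ->
  exists c : E -> 'I_((3 * k) %/ 2), proper_coloring setT c.
Proof.
move=> degk; set n := (3 * k) %/ 2.
suff H m (D : {set E}) : #|D| = m -> exists c : E -> 'I_n, proper_coloring D c.
  exact: H.
elim: m D => [|m IH] D.
  move/eqP; rewrite cards_eq0 => /eqP->.
  have [n0|n0] := posnP n; last first.
    by exists (fun=> Ordinal n0) => e e' v; rewrite inE.
  have E0 e : False.
    have := degk (a e); have : 0 < #|[set e' | ends e' (a e)]|.
      by apply/card_gt0P; exists e; rewrite inE /ends eqxx.
    by rewrite /n in n0; lia.
  by exists (fun e => False_rect _ (E0 e)) => e; case: (E0 e).
move=> Dm; have /card_gt0P[e0 e0D] : 0 < #|D| by rewrite Dm.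
set D' := D :\ e0; have D'm : #|D'| = m by have := cardsD1 e0 D; rewrite e0D Dm => -[].
have -> : D = e0 |: D' by rewrite setD1K.
have [c cD] := IH D' D'm.
pose M v := [set g | missing D' c v g].
have Mge v : n <= #|M v| + k.
  apply: leq_trans (card_missing D' c v) _; rewrite leq_add2l.
  apply: leq_trans (degk v); apply/subset_leq_card/subsetP => e.
  by rewrite !inE => /andP[].
have Mgt v : ends e0 v -> n < #|M v| + k.
  move=> e0v; apply: leq_ltn_trans (card_missing D' c v) _; rewrite ltn_add2l.
  apply: leq_trans (degk v); apply/proper_card/properP; split.
    by apply/subsetP => e; rewrite !inE => /andP[].
  by exists e0; rewrite !inE // eqxx.
set x := a e0; set y := b e0.
have e0x : ends e0 x by rewrite /ends eqxx.
have e0y : ends e0 y by rewrite /ends eqxx orbT.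
have kn : k <= n by rewrite /n; lia.
have Mnz v : ends e0 v -> exists g, missing D' c v g.
  move=> /Mgt H; have /card_gt0P[g] : 0 < #|M v| by lia.
  by rewrite inE; exists g.
have [g /andP[gx gy]|xy0] := pickP (fun g => missing D' c x g && missing D' c y g).
  exact: color_common cD gx gy.
have [al alx] := Mnz x e0x.
have /missingP aly : ~~ missing D' c y al by have := xy0 al; rewrite alx => /= ->.
have [e1 [e1D e1y ce1]] : exists e1, [/\ e1 \in D', ends e1 y & c e1 = al].
  apply: contrapT => H; apply: aly => e eD ey; apply/eqP => ce.
  by apply: H; exists e.
set z := opposite e1 y.
have e1z : ends e1 z by exact: ends_opposite.
have xz : x != z.
  apply/negP => /eqP xz; move/missingP/(_ e1 e1D): alx.
  by rewrite xz => /(_ e1z); rewrite ce1 eqxx.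
have [g /andP[gy gz]|yz0] := pickP (fun g => missing D' c y g && missing D' c z g).
  by apply: (color_shift cD e1D e1y) gy gz; rewrite ce1.
have [g /andP[gx gz]|xz0] := pickP (fun g => missing D' c x g && missing D' c z g).
  have [be bey] := Mnz y e0y.
  have c'D := kempe_swap_proper cD g bey.
  have yy : exists i, walk D' c be g y i = y by exists 0.
  have gy' : missing D' (kempe_swap D' c be g y) y g.
    have := kempe_swap_missing_in cD bey yy bey.
    by rewrite /transpose eqxx.
  have [xS|xS] := pselect (exists i, walk D' c be g y i = x); last first.
    exact: color_common c'D (kempe_swap_missing_notin cD bey xS gx) gy'.
  have zS : ~ exists i, walk D' c be g y i = z.
    move: xS => [i xi] [j zj]; move/eqP: xz; apply.
    by rewrite -xi -zj; apply: (walk_missing_unique cD bey); rewrite ?xi ?zj.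
  have alg : al != g.
    by apply: contraTneq gz => <-; apply/missingP => /(_ _ e1D e1z); rewrite ce1 eqxx.
  have alb : al != be.
    by apply: contraTneq bey => <-; apply/missingP.
  have tal : transpose be g al = al by rewrite /transpose (negbTE alg) (negbTE alb).
  have ce1' : kempe_swap D' c be g y e1 = al.
    by rewrite /kempe_swap ce1 tal if_same.
  apply: (color_shift c'D e1D e1y) gy' _.
    by rewrite ce1' -tal; apply: kempe_swap_missing_in.
  exact: kempe_swap_missing_notin.
exfalso.
have dis (u v : V) : (forall g, missing D' c u g && missing D' c v g = false) ->
    M u :&: M v = set0.
  by move=> H; apply/setP => g; rewrite !inE H.
have : #|(M x :|: M y) :|: M z| <= n by rewrite (leq_trans (max_card _)) ?card_ord.
rewrite !cardsU setIUl (dis x z) ?(dis y z) ?(dis x y) // setU0 cards0 !subn0.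
have := Mgt x e0x; have := Mgt y e0y; have := Mge z; rewrite /n; lia.
Qed.
End Shannon.

(** * Real functions modulo 1 *)

Section ModularContinuity.
Local Open Scope classical_set_scope.
Local Open Scope ring_scope.
Variable R : realType.
Implicit Types (x y e : R).

Definition mod1_close e x y := exists k : int, `|x - y - k%:~R| < e.

(* the representative of x modulo 1 in [-1/2, 1/2[ *)
Definition crep x : R := x - (Num.floor (x + 2^-1))%:~R.

Lemma crep_uniq x (k : int) : `|x - k%:~R| < 2^-1 -> crep x = x - k%:~R.
Proof.
rewrite ltr_norml => /andP[h1 h2]; rewrite /crep (@floor_def _ _ k) //.
by rewrite intrD; apply/andP; split; lra.
Qed.

Lemma crep_small x : `|x| < 2^-1 -> crep x = x.
Proof. by move=> h; rewrite (@crep_uniq x 0) ?subr0. Qed.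

Lemma crepE x : exists k : int, crep x = x + k%:~R.
Proof. by exists (- Num.floor (x + 2^-1)); rewrite intrN. Qed.

Lemma crepDz x (k : int) : crep (x + k%:~R) = crep x.
Proof.
by rewrite /crep [X in Num.floor X]addrAC (floorDrz _ (intr_int _ k)) intrKfloor intrD; lra.
Qed.

Lemma crep_lt e x (k : int) : e <= 2^-1 -> `|x - k%:~R| < e -> `|crep x| < e.
Proof. by move=> e2 h; rewrite (@crep_uniq x k)//; apply: lt_le_trans e2. Qed.

Lemma eq_small_diff_int x y (k : int) : y = x + k%:~R -> `|x| + `|y| < 1 -> x = y.
Proof.
move=> yx h; suff k0 : k = 0 by rewrite yx k0 addr0.
have : `|k%:~R : R| < 1.
  have -> : k%:~R = y - x by rewrite yx addrC addKr.
  by apply: le_lt_trans h; rewrite [leRHS]addrC ler_normB.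
by rewrite -intr_norm (ltr_int _ _ 1); lia.
Qed.

Section Modcont.
Variable T : topologicalType.
Implicit Types (S : set T) (f g : T -> R) (z : T).

(* [f] represents a map into R / Z, which is continuous at [z] within [S]. *)
Definition modcont S f z :=
  forall e, 0 < e -> \forall z' \near z, S z' -> mod1_close e (f z') (f z).


Lemma modcontD S f g z : modcont S f z -> modcont S g z ->
  modcont S (fun u => f u + g u) z.
Proof.
move=> cf cg e e0; have e2 : 0 < e / 2 by lra.
apply: filterS2 (cf _ e2) (cg _ e2) => z' fz gz Sz'.
have [[k fk] [l gl]] := (fz Sz', gz Sz').
exists (k + l); rewrite intrD.
have -> : f z' + g z' - (f z + g z) - (k%:~R + l%:~R) =
  (f z' - f z - k%:~R) + (g z' - g z - l%:~R) by ring.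
by apply: le_lt_trans (ler_normD _ _) _; lra.
Qed.

Lemma modcontMz S f z (m : int) : modcont S f z ->
  modcont S (fun u => m%:~R * f u) z.
Proof.
move=> cf e e0; have m0 : 0 < `|m%:~R : R| + 1 by rewrite ltr_wpDl.
have e2 : 0 < e / (`|m%:~R| + 1) by rewrite divr_gt0.
apply: filterS (cf _ e2) => z' fz Sz'; have [k fk] := fz Sz'.
exists (m * k); rewrite intrM -!mulrBr normrM.
rewrite ltr_pdivlMr // in fk; apply: le_lt_trans fk.
by rewrite mulrC ler_wpM2l // lerDl.
Qed.

Lemma modcontB S f g z : modcont S f z -> modcont S g z ->
  modcont S (fun u => f u - g u) z.
Proof.
move=> cf /(@modcontMz _ _ _ (-1)) /(modcontD cf) cg e /cg.
by apply: filterS => z' H /H; rewrite !intrN !mulN1r.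
Qed.

Lemma modcont_within S f z : f x @[x --> within S (nbhs z)] --> f z ->
  modcont S f z.
Proof.
move=> /cvgrPdist_lt cf e /cf; rewrite near_withinE; apply: filterS => z' H /H fz.
by exists 0; rewrite subr0 distrC.
Qed.

Lemma modcont_cvg S f z : {for z, continuous f} -> modcont S f z.
Proof. by move=> cf; apply: modcont_within; apply: cvg_within_filter. Qed.

Lemma modcont_congr S f g z :
  (forall z', S z' -> exists k : int, g z' = f z' + k%:~R) ->
  S z -> modcont S f z -> modcont S g z.
Proof.
move=> fg Sz cf e e0; apply: filterS (cf e e0) => z' fz Sz'.
have [k ->] := fg _ Sz'; have [l ->] := fg _ Sz; have [m fm] := fz Sz'.
exists (m + k - l); rewrite intrB intrD.
by have -> : f z' + k%:~R - (f z + l%:~R) - (m%:~R + k%:~R - l%:~R) =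
  f z' - f z - m%:~R by ring.
Qed.

Lemma modcont_sub S S' f z : S' `<=` S -> modcont S f z -> modcont S' f z.
Proof. by move=> SS cf e e0; apply: filterS (cf e e0) => z' H /SS. Qed.

Lemma modcont_nbhs S S' f z : nbhs z S -> modcont S f z -> modcont S' f z.
Proof. by move=> zS cf e e0; apply: filterS2 zS (cf e e0) => z' Sz' /(_ Sz'). Qed.

Lemma modcont_crep S f z : modcont S f z -> `|crep (f z)| < 4^-1 ->
  crep (f x) @[x --> within S (nbhs z)] --> crep (f z).
Proof.
move=> cf fz4; apply/cvgrPdist_lt => e e0; rewrite near_withinE.
have m0 : 0 < Num.min e 4^-1 by rewrite lt_min e0 /=; lra.
apply: filterS (cf _ m0) => z' fz' Sz'; have [k] := fz' Sz'.
rewrite lt_min => /andP[h1 h2]; have [j fj] := crepE (f z).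
rewrite (@crep_uniq (f z') (k - j)).
  rewrite distrC intrB fj.
  by have -> : f z' - (k%:~R - j%:~R) - (f z + j%:~R) = f z' - f z - k%:~R by ring.
rewrite intrB.
have -> : f z' - (k%:~R - j%:~R) = (f z' - f z - k%:~R) + crep (f z).
  by rewrite fj; ring.
by apply: le_lt_trans (ler_normD _ _) _; lra.
Qed.
End Modcont.

Lemma modcont_comp_within (T U : topologicalType) (S : set T) (S' : set U)
  (h : T -> U) (f : U -> R) z :
  h x @[x --> within S (nbhs z)] --> h z -> (forall x : T, S x -> S' (h x)) ->
  modcont S' f (h z) -> modcont S (f \o h) z.
Proof.
move=> ch hS cf e e0.
apply: (@filterS _ (nbhs z) _ _ _ _ (ch _ (cf e e0))) => z' H Sz'.
by apply: H => //; exact: hS.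
Qed.

Lemma modcont_comp (T U : topologicalType) (S : set T) (S' : set U)
  (h : T -> U) (f : U -> R) z :
  {for z, continuous h} -> (forall x : T, S x -> S' (h x)) -> modcont S' f (h z) ->
  modcont S (f \o h) z.
Proof. by move=> ch; apply: modcont_comp_within; apply: cvg_within_filter. Qed.

Lemma modcont_uniform (T : pseudoMetricType R) (K : set T) (f : T -> R) e :
  compact K -> (forall z, K z -> modcont K f z) -> 0 < e ->
  exists2 d, 0 < d &
    forall z z', K z -> K z' -> ball z d z' -> mod1_close e (f z') (f z).
Proof.
move=> /compact_near_coveringP cK cf e0; have e2 : 0 < e / 2 by lra.
have := cK R (0^'+) (fun d z => K z -> forall z', K z' -> ball z d z' ->
  mod1_close e (f z') (f z)) _.
case.
  move=> z Kz; have /nbhs_ballP[r /= r0 rf] := cf z Kz _ e2.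
  have r2 : 0 < r / 2 by lra.
  exists (ball z (r / 2), [set d | d < r / 2]).
    by split; [exact: nbhsx_ballx|exact: nbhs_right_lt].
  move=> [z1 d] /= [z1z dr] Kz1 z2 Kz2 z12.
  have [|k hk] := rf z1 _ Kz1.
    by apply: le_ball z1z; lra.
  have [|l hl] := rf z2 _ Kz2.
    by rewrite (splitr r); apply: ball_triangle z1z (le_ball (ltW dr) z12).
  exists (l - k); rewrite intrB.
  have -> : f z2 - f z1 - (l%:~R - k%:~R) =
    (f z2 - f z - l%:~R) - (f z1 - f z - k%:~R) by ring.
  by apply: le_lt_trans (ler_normB _ _) _; lra.
move=> r /= r0 H; exists (r / 2); first by lra.
move=> z z' Kz Kz' zz'; apply: (H (r / 2)) => //=; last by lra.
by rewrite sub0r normrN ger0_norm; lra.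
Qed.

Lemma modcont_lift (f : R -> R) :
  (forall t : R, 0 <= t <= 1 -> modcont `[0 : R, 1] f t) ->
  exists2 phi : R -> R, {within `[0, 1], continuous phi} &
    forall t : R, 0 <= t <= 1 -> exists k : int, phi t = f t + k%:~R.
Proof.
move=> cf; have e8 : 0 < 8^-1 :> R by lra.
have [|d d0 df] :=
  @modcont_uniform R `[0 : R, 1]%classic f _ (@segment_compact R 0 1) _ e8.
  by move=> z /=; rewrite in_itv /=; exact: cf.
have [N Nd] : exists N, d^-1 < N.+1%:R.
  exists (Num.truncn d^-1); apply: truncnS_gt.
pose q (i : nat) : R := i%:R / N.+1%:R.
have qq i : q i.+1 = q i + N.+1%:R^-1 by rewrite /q -natr1 mulrDl mul1r.
have N0 : 0 < N.+1%:R :> R by rewrite ltr0n.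
have q0 i : 0 <= q i by rewrite /q divr_ge0.
have Ninv : N.+1%:R^-1 < d by rewrite invf_plt.
have Ninv0 : 0 < N.+1%:R^-1 :> R by rewrite invr_gt0.
pose g i t := f (Num.min t (q i.+1)) - f (Num.min t (q i)).
have min01 i (t : R) : 0 <= t <= 1 -> 0 <= Num.min t (q i) <= 1.
  by move=> /andP[t0 t1]; rewrite le_min t0 q0 ge_min t1.
have gsmall i (t : R) : 0 <= t <= 1 -> `|crep (g i t)| < 4^-1.
  move=> t01; have [||| k hk] := df (Num.min t (q i)) (Num.min t (q i.+1)).
  - by rewrite /= in_itv /= min01.
  - by rewrite /= in_itv /= min01.
  - rewrite /ball /= ltr_norml qq; apply/andP.
    move: (N.+1%:R^-1) (q i) Ninv Ninv0 => h p Ninv Ninv0.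
    by split; case: (leP t p); case: (leP t (p + h)) => H1 H2; lra.
  by apply: (@crep_lt _ _ k); [lra|apply: lt_trans hk _; lra].
(* The increments of f over the steps up to t are small modulo 1, and their
   representatives add up to a lift. *)
exists (fun t => f 0 + \sum_(i < N.+1) crep (g i t)).
  apply/subspace_continuousP => t; rewrite /= in_itv /= => t01.
  apply: cvgD; first exact: cvg_cst.
  have sumc n (F : nat -> R -> R) :
      (forall i, F i x @[x --> within `[0, 1] (nbhs t)] --> F i t) ->
      \sum_(i < n) F i x @[x --> within `[0, 1] (nbhs t)] --> \sum_(i < n) F i t.
    move=> Fc; elim: n => [|n IH].
      by rewrite big_ord0; under eq_fun do rewrite big_ord0; exact: cvg_cst.
    rewrite big_ord_recr /=; under eq_fun do rewrite big_ord_recr /=.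
    exact: cvgD.
  apply: (sumc _ (fun i t => crep (g i t))) => i.
  apply: modcont_crep (gsmall i t t01).
  have minc j : modcont `[0 : R, 1] (fun t => f (Num.min t (q j))) t.
    apply: (@modcont_comp _ _ _ `[0 : R, 1]%classic (fun t => Num.min t (q j))).
    - by apply: continuous_min; [exact: cvg_id|exact: cvg_cst].
    - by move=> x; rewrite /= !in_itv /=; exact: min01.
    - by apply: cf; exact: min01.
  by apply: modcontB; exact: minc.
move=> t t01.
have H n : exists k : int, f 0 + \sum_(i < n) crep (g i t) = f (Num.min t (q n)) + k%:~R.
  elim: n => [|n [k IH]].
    by exists 0; rewrite big_ord0 /q mul0r min_r ?addr0 //; case/andP: t01.
  have [j hj] := crepE (g n t); exists (k + j).
  rewrite big_ord_recr /= addrA IH hj /g intrD; ring.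
have [k Hk] := H N.+1; exists k; rewrite Hk /q divff ?gt_eqF // min_l //.
by case/andP: t01.
Qed.
End ModularContinuity.

Section Winding.
Local Open Scope classical_set_scope.
Local Open Scope ring_scope.
Variable R : realType.
Implicit Types (x y e s t : R).

Definition unit_square : set (R * R) := `[0 : R, 1] `*` `[0 : R, 1].

(* The winding number of [h (s, -)] is computed on a fine grid as the sum of the
   small increments; it does not depend on [s], is 0 for [s = 0] and [m] for [s = 1]. *)
Lemma winding_square (h : R * R -> R) (m : int) :
  (forall z, unit_square z -> modcont unit_square h z) ->
  (forall t, h (0, t) = h (0, 0)) -> (forall s, h (s, 1) = h (s, 0)) ->
  (forall t, 0 <= t <= 1 -> exists k : int, h (1, t) = m%:~R * t + k%:~R) ->
  m = 0.
Proof.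
move=> ch h0 h01 h1; have e8 : 0 < 8^-1 :> R by lra.
have [d d0 dh] := modcont_uniform
  (compact_setX (@segment_compact R 0 1) (@segment_compact R 0 1)) ch e8.
have [N NP] : exists N, Num.max d^-1 (`|m|%:~R *+ 2) < N.+1%:R.
  by exists (Num.truncn (Num.max d^-1 (`|m|%:~R *+ 2))); apply: truncnS_gt.
move: NP; rewrite gt_max => /andP[Nd Nm].
have N0 : 0 < N.+1%:R :> R by rewrite ltr0n.
pose q (i : nat) : R := i%:R / N.+1%:R.
have qq i : q i.+1 = q i + N.+1%:R^-1 by rewrite /q -natr1 mulrDl mul1r.
have q0 : q 0%N = 0 by rewrite /q mul0r.
have q1 : q N.+1 = 1 by rewrite /q divff ?gt_eqF.
have q01 i : (i <= N.+1)%N -> 0 <= q i <= 1.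
  by move=> iN; rewrite /q divr_ge0 //= ler_pdivrMr // mul1r ler_nat.
have Ninv : N.+1%:R^-1 < d by rewrite invf_plt.
have Ninv0 : 0 < N.+1%:R^-1 :> R by rewrite invr_gt0.
have bq i : ball (q i) d (q i.+1).
  by rewrite /ball /= qq opprD addNKr normrN ger0_norm // ltW.
pose P i j := h (q i, q j).
have Kq i j : (i <= N.+1)%N -> (j <= N.+1)%N -> unit_square (q i, q j).
  by move=> iN jN; split; rewrite /= in_itv /= q01.
pose D i j := crep (P i j.+1 - P i j); pose V i j := crep (P i.+1 j - P i j).
have Dsmall i j : (i <= N.+1)%N -> (j < N.+1)%N -> `|D i j| < 8^-1.
  move=> iN jN; have [|||k hk] := dh (q i, q j) (q i, q j.+1).
  - by apply: Kq => //; exact: ltnW.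
  - exact: Kq.
  - by split => //=; exact: ballxx.
  by apply: (@crep_lt _ _ _ k) => //; lra.
have Vsmall i j : (i < N.+1)%N -> (j <= N.+1)%N -> `|V i j| < 8^-1.
  move=> iN jN; have [|||k hk] := dh (q i, q j) (q i.+1, q j).
  - by apply: Kq => //; exact: ltnW.
  - exact: Kq.
  - by split => //=; exact: ballxx.
  by apply: (@crep_lt _ _ _ k) => //; lra.
have cocycle i j : (i < N.+1)%N -> (j < N.+1)%N ->
    D i j + V i j.+1 = V i j + D i.+1 j.
  move=> iN jN.
  have [k1 e1] := crepE (P i j.+1 - P i j).
  have [k2 e2] := crepE (P i.+1 j.+1 - P i j.+1).
  have [k3 e3] := crepE (P i.+1 j - P i j).
  have [k4 e4] := crepE (P i.+1 j.+1 - P i.+1 j).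
  apply: (@eq_small_diff_int _ _ _ (k3 + k4 - k1 - k2)).
    by rewrite /D /V e1 e2 e3 e4 !(intrD, intrB); ring.
  have := Dsmall i j (ltnW iN) jN; have := Dsmall i.+1 j iN jN.
  have := Vsmall i j iN (ltnW jN); have := Vsmall i j.+1 iN jN.
  have := ler_normD (D i j) (V i j.+1); have := ler_normD (V i j) (D i.+1 j).
  by lra.
pose W i := \sum_(j < N.+1) D i j.
have WS i : (i < N.+1)%N -> W i.+1 = W i.
  move=> iN.
  have partial n : (n <= N.+1)%N ->
      \sum_(j < n) D i.+1 j = \sum_(j < n) D i j + V i n - V i 0%N.
    elim: n => [|n IH] nN; first by rewrite !big_ord0; ring.
    rewrite !big_ord_recr /= IH ?(ltnW nN) //.
    by have := cocycle i n iN nN; lra.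
  rewrite /W partial // /V /P q1 q0 !h01; ring.
have W0 i : (i <= N.+1)%N -> W i = 0.
  elim: i => [|i IH] iN; last by rewrite WS // IH // ltnW.
  rewrite /W big1 // => j _; rewrite /D /P q0 h0 (h0 (q j)) subrr.
  by rewrite crep_small ?normr0 //; lra.
have := W0 N.+1 (leqnn _); rewrite /W (eq_bigr (fun=> m%:~R / N.+1%:R)).
  rewrite sumr_const card_ord -[_ *+ N.+1]mulr_natr mulfVK ?gt_eqF // => /eqP.
  by rewrite intr_eq0 => /eqP.
move=> j _; rewrite /D /P q1.
have [k ->] := h1 _ (q01 j.+1 (ltn_ord j)).
have [l ->] := h1 _ (q01 j (ltnW (ltn_ord j))).
rewrite qq; have -> : m%:~R * (q j + N.+1%:R^-1) + k%:~R - (m%:~R * q j + l%:~R) =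
  m%:~R / N.+1%:R + (k - l)%:~R by rewrite intrB; ring.
rewrite crepDz crep_small // normrM normfV -intr_norm.
rewrite (gtr0_norm N0) ltr_pdivrMr //; move: Nm; rewrite mulr2n; lra.
Qed.

(* The angle of a nonzero vector, as a fraction of a full turn, measured along
   the unit circle of the l1 norm. *)
Definition ang (z : plane R) : R :=
  let c := (1 - z.1 / (`|z.1| + `|z.2|)) / 4 in if 0 <= z.2 then c else - c.

Lemma l1_gt0 (z : plane R) : z != 0 -> 0 < `|z.1| + `|z.2|.
Proof.
case: z => x y /=; rewrite lt0r addr_ge0 // andbT => xy.
by apply: contra xy; rewrite paddr_eq0 // !normr_eq0 => /andP[/eqP-> /eqP->].
Qed.

Lemma ang_close (z z' : plane R) e : z != 0 -> z' != 0 -> e <= 8^-1 ->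
  `|z'.1 - z.1| + `|z'.2 - z.2| <= e * (`|z.1| + `|z.2|) ->
  exists k : int, `|ang z' - ang z - k%:~R| <= e.
Proof.
move=> /l1_gt0 + /l1_gt0; case: z z' => x y [x' y'] /=.
set s := `|x| + `|y|; set s' := `|x'| + `|y'| => s0 s'0 e8 H.

have e0 : 0 <= e.
  by rewrite -(pmulr_lge0 _ s0); apply: le_trans H; rewrite addr_ge0.
have es : e * s <= s / 8 by rewrite mulrC ler_pM2l.
have ss : `|s - s'| <= `|x' - x| + `|y' - y|.
  have -> : s - s' = (`|x| - `|x'|) + (`|y| - `|y'|) by rewrite /s /s'; ring.
  apply: le_trans (ler_normD _ _) _; rewrite (distrC x') (distrC y').
  by rewrite lerD // ler_dist_dist.
have uu : `|x' / s' - x / s| <= 2 * e.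
  have -> : x' / s' - x / s = ((x' - x) + (x' / s') * (s - s')) / s.
    by field; rewrite !gt_eqF.
  rewrite normrM normfV (gtr0_norm s0) ler_pdivrMr //.
  apply: le_trans (ler_normD _ _) _; rewrite normrM.
  have : `|x' / s'| <= 1.
    by rewrite normrM normfV (gtr0_norm s'0) ler_pdivrMr // mul1r lerDl.
  move=> /(ler_wpM2r (normr_ge0 (s - s'))); rewrite mul1r.
  have := normr_ge0 (y' - y); rewrite -mulrA; lra.
have same : `|(1 - x' / s') / 4 - (1 - x / s) / 4| <= e.
  have -> : (1 - x' / s') / 4 - (1 - x / s) / 4 = - (x' / s' - x / s) / 4 by field;
    rewrite !gt_eqF.
  rewrite normrM normrN [ `|4^-1|]ger0_norm; last by lra.
  by lra.
have opp : `|y| + `|y'| <= `|y' - y| -> exists k : int,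
    `|(1 - x' / s') / 4 + (1 - x / s) / 4 - k%:~R| <= e.
  move=> yy.
  have sx : `|x| >= 7 / 8 * s.
    by have := normr_ge0 y'; have := normr_ge0 (x' - x); have sE : `|x| + `|y| = s by []; lra.
  have v1 : `|y| / s <= e.
    by rewrite ler_pdivrMr //; have := normr_ge0 y'; have := normr_ge0 (x' - x); lra.
  have v2 : `|y'| / s' <= 2 * e.
    have : s <= 2 * s'.
      by move: ss; rewrite ler_norml => /andP[]; lra.
    move=> /(ler_wpM2l e0) ess.
    by rewrite ler_pdivrMr //; have := normr_ge0 y; have := normr_ge0 (x' - x); lra.
  have v1' : 0 <= `|y| / s by rewrite divr_ge0 // ltW.
  have v2' : 0 <= `|y'| / s' by rewrite divr_ge0 // ltW.
  have xx : `|x' - x| <= s / 8 by have := normr_ge0 (y' - y); lra.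
  have [xp|xn] := lerP 0 x.
    rewrite (ger0_norm xp) in sx.
    have x'p : 0 <= x' by move: xx; rewrite ler_norml => /andP[]; lra.
    have -> : x / s = 1 - `|y| / s.
      rewrite -{1}(ger0_norm xp); apply: (canRL (addrK _)).
      by rewrite -mulrDl divff ?gt_eqF.
    have -> : x' / s' = 1 - `|y'| / s'.
      rewrite -{1}(ger0_norm x'p); apply: (canRL (addrK _)).
      by rewrite -mulrDl divff ?gt_eqF.
    by exists 0; rewrite subr0 ger0_norm; lra.
  rewrite (ltr0_norm xn) in sx.
  have x'n : x' <= 0 by move: xx; rewrite ler_norml => /andP[]; lra.
  have -> : x / s = `|y| / s - 1.
    apply: oppr_inj; rewrite opprB -mulNr -(ltr0_norm xn).
    apply: (canRL (addrK _)); by rewrite -mulrDl divff ?gt_eqF.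
  have -> : x' / s' = `|y'| / s' - 1.
    apply: oppr_inj; rewrite opprB -mulNr -(ler0_norm x'n).
    apply: (canRL (addrK _)); by rewrite -mulrDl divff ?gt_eqF.
  by exists 1; rewrite ler_norml; apply/andP; split; lra.
rewrite /ang /= -/s -/s'; case: (lerP 0 y') => y'p; case: (lerP 0 y) => yp.
- by exists 0; rewrite subr0.
- have [|k hk] := opp; last by exists k; rewrite opprK.
  by rewrite (ger0_norm y'p) (ltr0_norm yp) ger0_norm; lra.
- have [|k hk] := opp.
    by rewrite (ltr0_norm y'p) (ger0_norm yp) ler0_norm; lra.
  exists (- k); rewrite intrN -!opprD normrN //.
- by exists 0; rewrite subr0 -opprD normrN.
Qed.

Lemma ang_modcont (S : set (plane R)) (p z : plane R) : z != p ->
  modcont S (fun u : plane R => ang (u - p)) z.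
Proof.
move=> zp e e0; have s0 : 0 < `|(z - p).1| + `|(z - p).2|.
  by apply: l1_gt0; rewrite subr_eq0.
set s := _ + _ in s0.
pose d := Num.min (Num.min (e / 2) 8^-1 * s / 2) (s / 4).
have m0 : 0 < Num.min (e / 2) 8^-1 by rewrite lt_min; apply/andP; split; lra.
have d0 : 0 < d by rewrite lt_min !mulr_gt0 //; lra.
apply/nbhs_ballP; exists d => //= z' [/= z1 z2] _.
rewrite /ball /= distrC in z1; rewrite /ball /= distrC in z2.
have dd : d <= Num.min (e / 2) 8^-1 * s / 2 by rewrite ge_min lexx.
have d4 : d <= s / 4 by rewrite ge_min lexx orbT.
have z'p : z' != p.
  apply/eqP => z'p; rewrite z'p in z1 z2.
  rewrite /s /= -!(distrC p.1) -!(distrC p.2) in d4.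
  by lra.
have [||||k hk] := @ang_close (z - p) (z' - p) (Num.min (e / 2) 8^-1).
- by rewrite subr_eq0.
- by rewrite subr_eq0.
- by rewrite ge_min lexx orbT.
- rewrite /= -/s; have -> : z'.1 - p.1 - (z.1 - p.1) = z'.1 - z.1 by ring.
  have -> : z'.2 - p.2 - (z.2 - p.2) = z'.2 - z.2 by ring.
  by lra.
- exists k; apply: le_lt_trans hk _; rewrite gt_min; apply/orP; left; lra.
Qed.
End Winding.

Section Boundary.
Local Open Scope classical_set_scope.
Local Open Scope ring_scope.
Variable R : realType.
Implicit Types (x y e s t : R).

Definition diamond t : plane R :=
  (`|4 * t - 2| - 1, Num.max (1 - `|4 * t - 1|) (4 * t - 4)).

Lemma diamond_l1 t : 0 <= t <= 1 -> `|(diamond t).1| + `|(diamond t).2| = 1.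
Proof.
move=> /andP[t0 t1] /=.
have [h|h] := lerP t 4^-1.
  rewrite (ler0_norm (_ : 4 * t - 2 <= 0)) ?(ler0_norm (_ : 4 * t - 1 <= 0)); try lra.
  by rewrite max_l ?ger0_norm ?ger0_norm; lra.
have [h2|h2] := lerP t 2^-1.
  rewrite (ler0_norm (_ : 4 * t - 2 <= 0)) ?(ger0_norm (_ : 0 <= 4 * t - 1)); try lra.
  rewrite max_l; try lra.
  rewrite (ler0_norm (_ : _ - 1 <= 0)); try lra.
  by rewrite ger0_norm; lra.
rewrite (ger0_norm (_ : 0 <= 4 * t - 2)) ?(ger0_norm (_ : 0 <= 4 * t - 1)); try lra.
have [h3|h3] := lerP t (3 / 4).
  by rewrite max_l ?ler0_norm ?ler0_norm; lra.
rewrite max_r; try lra.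
rewrite (ger0_norm (_ : 0 <= _ - 1)); try lra.
by rewrite ler0_norm; lra.
Qed.

Lemma ang_diamond r t : 0 < r -> 0 <= t <= 1 ->
  exists k : int, ang (r * (diamond t).1, r * (diamond t).2) = t + k%:~R.
Proof.
move=> r0 t01; have d1 := diamond_l1 t01; case/andP: t01 => t0 t1.
rewrite /ang; set x := (diamond t).1 in d1 *; set y := (diamond t).2 in d1 *.
rewrite [(r * x, r * y).1]/= [(r * x, r * y).2]/= pmulr_rge0 //.
rewrite !normrM (gtr0_norm r0) -mulrDr d1 mulr1.
have -> : r * x / r = x by field; rewrite gt_eqF.
rewrite /x /y /=; have [th|th] := lerP t 2^-1.
  have -> : 0 <= Num.max (1 - `|4 * t - 1|) (4 * t - 4).
    by rewrite le_max; apply/orP; left; rewrite subr_ge0 ler_norml; apply/andP; split; lra.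
  by exists 0; rewrite ler0_norm; lra.
have [->|tn1] := eqVneq t 1.
  have -> : 0 <= Num.max (1 - `|4 * 1 - 1|) (4 * 1 - 4) :> R.
    by rewrite le_max; apply/orP; right; lra.
  by exists (-1); rewrite intrN ger0_norm; lra.
have t1' : t < 1 by rewrite lt_neqAle tn1.
have -> : 0 <= Num.max (1 - `|4 * t - 1|) (4 * t - 4) = false.
  apply: negbTE; rewrite -ltNge gt_max.
  by apply/andP; split; rewrite ?ger0_norm; lra.
by exists (-1); rewrite intrN ger0_norm; lra.
Qed.

Lemma diamond_loop_continuous (p : plane R) r :
  continuous (fun st : R * R =>
    (p.1 + st.1 * (r * (diamond st.2).1), p.2 + st.1 * (r * (diamond st.2).2)) : plane R).
Proof.
move=> st.
have c4 (a b : R) : (fun st : R * R => a * st.2 - b) @ st --> a * st.2 - b.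
  by apply: cvgB; [apply: cvgM; [exact: cvg_cst|exact: cvg_snd]|exact: cvg_cst].
have c1 : (fun st : R * R => (diamond st.2).1) @ st --> (diamond st.2).1.
  by apply: cvgB; [apply: cvg_norm; exact: c4|exact: cvg_cst].
have c2 : (fun st : R * R => (diamond st.2).2) @ st --> (diamond st.2).2.
  apply: (@continuous_max R _ (fun st : R * R => 1 - `|4 * st.2 - 1| : R^o)
    (fun st : R * R => 4 * st.2 - 4 : R^o)); last exact: c4.
  by apply: cvgB; [exact: cvg_cst|apply: cvg_norm; exact: c4].
have c (a : R) (f : R * R -> R) : f @ st --> f st ->
    (fun st : R * R => a + st.1 * (r * f st)) @ st --> a + st.1 * (r * f st).
  move=> cf; apply: cvgD; first exact: cvg_cst.
  by apply: cvgM; [exact: cvg_fst|apply: cvgM; [exact: cvg_cst|]].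
exact: (cvg_pair (c _ _ c1) (c _ _ c2)).
Qed.

(* Gluing [Q] on [U] with [m * ang (z - p)] outside of [U] gives a map from the
   plane to the circle with winding number [m] along a large diamond. *)
Lemma boundary_degree_eq0 (U : set (plane R)) (p : plane R) (r : R) (m : int)
    (Q : plane R -> R) :
  open U -> U p -> (forall z, U z -> `|z.1 - p.1| + `|z.2 - p.2| < r) ->
  (forall z, closure U z -> modcont (closure U) Q z) ->
  (forall z, closure U z -> ~ U z ->
     exists k : int, Q z = m%:~R * ang (z - p) + k%:~R) ->
  m = 0.
Proof.
move=> oU Up Ur cQ QU.
have r0 : 0 < r by have := Ur p Up; rewrite !subrr normr0 addr0.
pose F z := if `[< U z >] then Q z else m%:~R * ang (z - p).
have FU z : U z -> F z = Q z by move=> Uz; rewrite /F asboolT.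
have FNU z : ~ U z -> F z = m%:~R * ang (z - p) by move=> Uz; rewrite /F asboolF.
have cF z : modcont setT F z.
  have [Uz|Uz] := pselect (U z).
    apply: (@modcont_nbhs _ _ U); first exact: open_nbhs_nbhs.
    apply: (modcont_congr _ Uz (modcont_sub _ (cQ z (subset_closure Uz)))).
      by move=> z' /FU ->; exists 0; rewrite addr0.
    exact: subset_closure.
  move=> e e0.
  have zp : z != p by apply: contra_notN Uz => /eqP->.
  have near1 : \forall z' \near z, ~ U z' -> mod1_close e (F z') (F z).
    apply: filterS (modcontMz m (ang_modcont setT zp) e0) => z' H Uz'.
    by rewrite !FNU //; exact: H.
  have near2 : \forall z' \near z, U z' -> mod1_close e (F z') (F z).
    have [Cz|Cz] := pselect (closure U z).
      apply: filterS (cQ z Cz e e0) => z' H Uz'.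
      have [k hk] := H (subset_closure Uz'); have [l hl] := QU z Cz Uz.
      exists (k + l); rewrite FU // FNU // intrD.
      have -> : Q z' - m%:~R * ang (z - p) - (k%:~R + l%:~R) =
        Q z' - (m%:~R * ang (z - p) + l%:~R) - k%:~R by ring.
      by rewrite -hl.
    have : nbhs z (~` closure U).
      by apply: open_nbhs_nbhs; split => //; apply: closed_openC; exact: closed_closure.
    by apply: filterS => z' H Uz'; case: H; exact: subset_closure.
  apply: filterS2 near1 near2 => z' H1 H2 _.
  by have [|] := pselect (U z').
pose pt (st : R * R) : plane R :=
  (p.1 + st.1 * (r * (diamond st.2).1), p.2 + st.1 * (r * (diamond st.2).2)).
apply: (@winding_square _ (F \o pt)).
- move=> z _; apply: (@modcont_comp _ _ _ _ setT) => //.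
  exact: diamond_loop_continuous.
- by move=> t; rewrite /= /pt /= !mul0r.
- move=> s; rewrite /= /pt /=; do 2?congr (F (_, _)).
    congr (_ + s * (r * _)); rewrite ger0_norm; last by lra.
    by rewrite ler0_norm; lra.
  congr (_ + s * (r * _)); rewrite ger0_norm; last by lra.
  rewrite ler0_norm; last by lra.
  by rewrite max_r ?max_l; lra.
- move=> t t01; rewrite /= FNU.
    have -> : pt (1, t) - p = (r * (diamond t).1, r * (diamond t).2).
      by rewrite /pt /=; apply/pair_equal_spec; split => /=; ring.
    have [k ->] := ang_diamond r0 t01; exists (m * k).
    by rewrite intrM mulrDr.
  move=> /Ur; rewrite /pt /= !mul1r !(addrC p.1) !(addrC p.2) !addrK !normrM.
  by rewrite (gtr0_norm r0) -mulrDr (diamond_l1 t01) mulr1 ltxx.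
Qed.
End Boundary.

(** * Complements of compact plane sets *)

Section Components.
Local Open Scope classical_set_scope.
Local Open Scope ring_scope.
Variable R : realType.
Implicit Types (x y z p : plane R) (A : set (plane R)).

Definition seg_point x y (t : R) : plane R :=
  (x.1 + t * (y.1 - x.1), x.2 + t * (y.2 - x.2)).

Definition seg x y : set (plane R) := seg_point x y @` `[0 : R, 1].

Lemma seg_point0 x y : seg_point x y 0 = x.
Proof. by case: x => a b; rewrite /seg_point /= !mul0r !addr0. Qed.

Lemma seg_point1 x y : seg_point x y 1 = y.
Proof. by case: y => a b; rewrite /seg_point /= !mul1r !(addrC x.1, addrC x.2) !subrK. Qed.

Lemma seg_point_continuous x y : continuous (seg_point x y).
Proof.
move=> t; have c (a b : R) : (fun t : R => a + t * b) @ t --> a + t * b.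
  by apply: cvgD; [exact: cvg_cst|apply: cvgM; [exact: cvg_id|exact: cvg_cst]].
exact: (cvg_pair (c x.1 (y.1 - x.1)) (c x.2 (y.2 - x.2))).
Qed.

Lemma seg_connected x y : connected (seg x y).
Proof.
apply: connected_continuous_connected; first exact: segment_connected.
exact/continuous_subspaceT/seg_point_continuous.
Qed.

Lemma seg_left x y : seg x y x.
Proof. by exists 0; [rewrite /= in_itv /= lexx ler01|exact: seg_point0]. Qed.

Lemma seg_right x y : seg x y y.
Proof. by exists 1; [rewrite /= in_itv /= lexx ler01|exact: seg_point1]. Qed.

Lemma component_seg A x y z : connected_component A x y -> seg y z `<=` A ->
  connected_component A x z.
Proof.
move=> Axy yz; apply: (connected_component_trans Axy).
by apply: (connected_component_max (seg_left y z)) => //;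
  [exact: seg_connected|exact: seg_right].
Qed.

Lemma seg_ball p (r : R) x y : ball p r x -> ball p r y -> seg x y `<=` ball p r.
Proof.
have conv (a b c t : R) : 0 <= t <= 1 -> `|a - b| < r -> `|a - c| < r ->
    `|a - (b + t * (c - b))| < r.
  move=> /andP[t0 t1] h1 h2.
  have -> : a - (b + t * (c - b)) = (1 - t) * (a - b) + t * (a - c) by ring.
  apply: le_lt_trans (ler_normD _ _) _; rewrite !normrM (ger0_norm t0) ger0_norm ?subr_ge0 //.
  have [tm|tm] := lerP `|a - b| `|a - c|; nra.
move=> [x1 x2] [y1 y2] ? [t /=]; rewrite in_itv /= => t01 <-.
by split; rewrite /ball /=; apply: conv.
Qed.

Lemma component_open A x : open A -> open (connected_component A x).
Proof.
move=> oA; rewrite openE => y xy.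
have /nbhs_ballP[r /= r0 rA] : nbhs y A.
  by apply: open_nbhs_nbhs; split => //; exact: connected_component_sub xy.
apply/nbhs_ballP; exists r => //= z yz.
apply: (component_seg xy); apply: subset_trans rA; apply: seg_ball => //.
exact: ballxx.
Qed.

Lemma component_closure A x z : open A -> closure (connected_component A x) z ->
  A z -> connected_component A x z.
Proof.
move=> oA Cz Az; have /nbhs_ballP[r /= r0 rA] : nbhs z A by apply: open_nbhs_nbhs.
have [y [xy zy]] := Cz _ (nbhsx_ballx z r r0).
apply: (component_seg xy); apply: subset_trans rA; apply: seg_ball => //.
exact: ballxx.
Qed.

Lemma component_far A (M : R) z : 0 < M ->
  (forall x, M <= `|x.1| \/ M <= `|x.2| -> A x) ->
  M <= `|z.1| \/ M <= `|z.2| ->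
  connected_component A z (2 * M, 2 * M).
Proof.
move=> M0 MA Mz; have Azz := connected_component_refl (MA z Mz).
have conv (a b t : R) : 0 <= t <= 1 -> M <= a -> M <= b -> M <= a + t * (b - a).
  by move=> /andP[t0 t1] Ma Mb; nra.
have s1 x y : M <= x.1 -> M <= y.1 -> seg x y `<=` A.
  move=> h1 h2 ? [t /=]; rewrite in_itv /= => t01 <-; apply: MA; left => /=.
  by apply: le_trans (ler_norm _); exact: conv.
have s2 x y : M <= x.2 -> M <= y.2 -> seg x y `<=` A.
  move=> h1 h2 ? [t /=]; rewrite in_itv /= => t01 <-; apply: MA; right => /=.
  by apply: le_trans (ler_norm _); exact: conv.
have n1 x y : M <= - x.1 -> M <= - y.1 -> seg x y `<=` A.
  move=> h1 h2 ? [t /=]; rewrite in_itv /= => t01 <-; apply: MA; left => /=.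
  by rewrite -normrN; apply: le_trans (ler_norm _); have := conv _ _ _ t01 h1 h2; lra.
have n2 x y : M <= - x.2 -> M <= - y.2 -> seg x y `<=` A.
  move=> h1 h2 ? [t /=]; rewrite in_itv /= => t01 <-; apply: MA; right => /=.
  by rewrite -normrN; apply: le_trans (ler_norm _); have := conv _ _ _ t01 h1 h2; lra.
case: Mz; rewrite ler_normr => /orP[] h.
- by apply: (component_seg Azz); apply: s1 => //=; lra.
- apply: (@component_seg _ _ (- (2 * M), 2 * M)); last by apply: s2 => /=; lra.
  by apply: (component_seg Azz); apply: n1 => //=; lra.
- by apply: (component_seg Azz); apply: s2 => //=; lra.
- apply: (@component_seg _ _ (2 * M, - (2 * M))); last by apply: s1 => /=; lra.
  by apply: (component_seg Azz); apply: n2 => //=; lra.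
Qed.

Lemma compact_l1_bound A : compact A -> exists2 M : R, 0 < M &
  forall x, A x -> `|x.1| < M /\ `|x.2| < M.
Proof.
move=> /compact_bounded [M [_ HM]]; pose M' := Num.max M 0 + 1.
have MM : M < M' by rewrite (@le_lt_trans _ _ (Num.max M 0)) ?le_max ?lexx // ltrDl.
exists (M' + 1); first by rewrite addr_gt0 // ltr_wpDl // le_max lexx orbT.
move=> x Ax; have /= := HM _ MM x Ax; rewrite /Num.norm /= ge_max => /andP[h1 h2].
by split; [apply: le_lt_trans h1 _|apply: le_lt_trans h2 _]; rewrite ltrDl.
Qed.

Lemma compact_inv_continuous (g : R -> plane R) (psi : plane R -> R) :
  {within `[0, 1], continuous g} ->
  {within `[0, 1], continuous (psi \o g)} ->
  {within g @` `[0, 1], continuous psi}.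
Proof.
move=> cg cpsi; apply/continuous_closedP => C cC; apply/closed_subspaceP.
have /continuous_closedP/(_ C cC)/closed_subspaceP[V cV VE] := cpsi.
exists (g @` (V `&` `[0, 1])).
  apply: compact_closed; first exact: norm_hausdorff.
  apply: continuous_compact.
    by apply: continuous_subspaceW cg => x [].
  apply: subclosed_compact (@segment_compact R 0 1) _; last by move=> x [].
  by apply: closedI cV _; exact: interval_closed.
rewrite eqEsubset; split => z.
  move=> [[t [Vt t01] <-] _]; split; last by exists t.
  by have : (V `&` `[0, 1]) t by []; rewrite VE => -[].
move=> [Cz [t t01 tz]]; split; last by exists t.
exists t => //; have : ((psi \o g) @^-1` C `&` `[0, 1]) t by split => //=; rewrite tz.
by rewrite -VE.
Qed.
End Components.

Section TwoSides.
Local Open Scope classical_set_scope.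
Local Open Scope ring_scope.
Variable R : realType.
Implicit Types (x y z p : plane R) (A B K : set (plane R)).

Lemma bounded_component_degree_eq0 K (M : R) (Theta : plane R -> R) p p' p''
    (m m' m'' : int) :
  closed K -> continuous Theta ->
  ~ K p -> ~ K p' -> ~ K p'' ->
  ~ connected_component (~` K) p p' -> ~ connected_component (~` K) p p'' ->
  (forall z, connected_component (~` K) p z -> `|z.1| < M /\ `|z.2| < M) ->
  (forall z, K z -> exists k : int, Theta z = m%:~R * ang (z - p) +
     m'%:~R * ang (z - p') + m''%:~R * ang (z - p'') + k%:~R) ->
  m = 0.
Proof.
move=> cK cT Kp Kp' Kp'' pp' pp'' bM TK; pose U := connected_component (~` K) p.
have oK : open (~` K) by rewrite openC.
have oU : open U by exact: component_open.
have Up : U p by exact: connected_component_refl.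
have neq z q : closure U z -> ~ K q -> ~ U q -> z != q.
  move=> Uz Kq Uq; apply/eqP => zq; apply: Uq.
  by apply: component_closure => //; rewrite -zq.
apply: (@boundary_degree_eq0 _ U p (4 * M) m
  (fun z => Theta z - m'%:~R * ang (z - p') - m''%:~R * ang (z - p''))) => //.
- move=> z /bM [z1 z2]; have [p1 p2] := bM _ Up.
  have := ler_normB z.1 p.1; have := ler_normB z.2 p.2; lra.
- move=> z Uz; apply: modcontB; last first.
    by apply: modcontMz; apply: ang_modcont; apply: neq.
  apply: modcontB; last by apply: modcontMz; apply: ang_modcont; apply: neq.
  exact/modcont_cvg/cT.
- move=> z Uz NUz; have [|k ->] := TK z.
    by apply: contrapT => Kz; apply: NUz; exact: component_closure.
  by exists k; ring.
Qed.


Lemma arc_two_sides A (g : R -> plane R) (r : R) w p1 p2 p3 : 0 < r ->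
  compact A -> {within `[0, 1], continuous g} -> {in `[0, 1] &, injective g} ->
  A `&` (g @` `[0, 1]) `<=` [set g 0; g 1] ->
  (forall z, ball w r z -> ~ A z) ->
  (forall p, p \in [:: p1; p2; p3] -> ball w (r / 64) p /\ ~ (g @` `[0, 1]) p) ->
  let C := connected_component (~` (A `|` g @` `[0, 1])) in
  [\/ C p1 p2, C p1 p3 | C p2 p3].
Proof.
move=> r0 coA cg ig AB wA pw; set B := g @` `[0, 1]; set K := A `|` B => C.
have cA : closed A by apply: compact_closed => //; exact: norm_hausdorff.
have coB : compact B by apply: continuous_compact => //; exact: segment_compact.
have cB : closed B by apply: compact_closed => //; exact: norm_hausdorff.
have cK : closed K by exact: closedU.
have Kp p : p \in [:: p1; p2; p3] -> ~ K p.
  by move=> /pw[wp Bp] [|//]; apply: wA; apply: le_ball wp; lra.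
have [p1in p2in p3in] : [/\ p1 \in [:: p1; p2; p3], p2 \in [:: p1; p2; p3]
    & p3 \in [:: p1; p2; p3]] by rewrite !inE !eqxx !orbT.
have lift p : p \in [:: p1; p2; p3] -> exists2 b : R -> R,
    {within `[0, 1], continuous b} &
    forall t : R, 0 <= t <= 1 -> exists k : int, b t = ang (g t - p) + k%:~R.
  move=> /pw[_ Bp]; apply: (@modcont_lift R (fun t => ang (g t - p))) => t t01.
  apply: (@modcont_comp_within _ _ _ _ setT g (fun z => ang (z - p))) => //.
    by move/subspace_continuousP: cg; apply; rewrite /= in_itv.
  apply: ang_modcont; apply: contra_notN Bp => /eqP <-.
  by exists t => //; rewrite /= in_itv.
have [b1 cb1 b1E] := lift p1 p1in.
have [b2 cb2 b2E] := lift p2 p2in.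
have [b3 cb3 b3E] := lift p3 p3in.
pose a p z := crep (ang (z - p) - ang (z - p3)).
have ca p : p \in [:: p1; p2; p3] -> {within A, continuous (a p)}.
  move=> pin; apply/subspace_continuousP => z Az.
  have zne q : q \in [:: p1; p2; p3] -> z != q.
    by move=> /Kp Kq; apply: contra_notN Kq => /eqP <-; left.
  apply: (@modcont_crep _ _ _ (fun z => ang (z - p) - ang (z - p3))).
    by apply: modcontB; apply: ang_modcont; apply: zne.
  have [[/= wp1 wp2] _] := pw p pin; have [[/= w31 w32] _] := pw p3 p3in.
  have zr : r <= `|w.1 - z.1| \/ r <= `|w.2 - z.2|.
    have [h1|h1] := lerP r `|w.1 - z.1|; first by left.
    have [h2|h2] := lerP r `|w.2 - z.2|; first by right.
    by case: (wA z).
  have [||||k hk] := @ang_close _ (z - p3) (z - p) 8^-1.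
  - by rewrite subr_eq0 zne.
  - by rewrite subr_eq0 zne.
  - by [].
  - rewrite /=.
    have -> : z.1 - p.1 - (z.1 - p3.1) = (w.1 - p.1) - (w.1 - p3.1) by ring.
    have -> : z.2 - p.2 - (z.2 - p3.2) = (w.2 - p.2) - (w.2 - p3.2) by ring.
    have := ler_normB (w.1 - p.1) (w.1 - p3.1).
    have := ler_normB (w.2 - p.2) (w.2 - p3.2).
    have := ler_distD p3.1 w.1 z.1; have := ler_distD p3.2 w.2 z.2.
    rewrite /ball /= in wp1 wp2 w31 w32.
    have := normr_ge0 (w.1 - z.1); have := normr_ge0 (w.2 - z.2).
    rewrite (distrC z.1) (distrC z.2).
    have := normr_ge0 (p3.1 - z.1); have := normr_ge0 (p3.2 - z.2).
    by case: zr; lra.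
  - by apply: (@crep_lt _ _ _ k); [lra|apply: le_lt_trans hk _; lra].
have itv0 : (0 : R) \in `[0, 1] by rewrite in_itv /= lexx ler01.
have itv1 : (1 : R) \in `[0, 1] by rewrite in_itv /= lexx ler01.
have jump p b t : (forall t : R, 0 <= t <= 1 ->
    exists k : int, b t = ang (g t - p) + k%:~R) -> 0 <= t <= 1 ->
    exists k : int, b t - b3 t = a p (g t) + k%:~R.
  move=> bE t01; have [k ->] := bE t t01; have [l ->] := b3E t t01.
  have [j aE] := crepE (ang (g t - p) - ang (g t - p3)).
  by exists (k - l - j); rewrite /a aE !intrB; ring.
have t00 : 0 <= (0 : R) <= 1 by rewrite lexx ler01.
have t11 : 0 <= (1 : R) <= 1 by rewrite lexx ler01.
have [k1 k1E] := jump p1 b1 0 b1E t00.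
have [l1 l1E] := jump p1 b1 1 b1E t11.
have [k2 k2E] := jump p2 b2 0 b2E t00.
have [l2 l2E] := jump p2 b2 1 b2E t11.
have [m1 [m2 [m0 mE]]] : exists m1 m2 : int, ~ (m1 = 0 /\ m2 = 0) /\
    m1 * (l1 - k1) + m2 * (l2 - k2) = 0.
  have [n1|n1] := eqVneq (l1 - k1) 0.
    by exists 1, 0; split; [case|rewrite n1 mulr0 mul0r].
  exists (l2 - k2), (- (l1 - k1)); split; last by ring.
  by case=> _ /eqP; rewrite oppr_eq0 (negbTE n1).
pose ginv z := xget 0 [set t : R | 0 <= t <= 1 /\ g t = z].
have ginvK t : 0 <= t <= 1 -> ginv (g t) = t.
  move=> t01; rewrite /ginv; case: xgetP => [t' _ [t'01 gt']|/(_ t)]; last by case.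
  by apply: ig; rewrite ?in_itv.
pose bB t := m1%:~R * (b1 t - b3 t) + m2%:~R * (b2 t - b3 t).
pose aA z := m1%:~R * a p1 z + m2%:~R * a p2 z + (m1 * k1 + m2 * k2)%:~R.
pose psi z := if `[< B z >] then bB (ginv z) else aA z.
have psiB t : 0 <= t <= 1 -> psi (g t) = bB t.
  move=> t01; rewrite /psi asboolT ?ginvK //.
  by exists t => //; rewrite /= in_itv.
have psiA z : A z -> psi z = aA z.
  move=> Az; rewrite /psi; case: asboolP => // Bz.
  have [->|->] : z = g 0 \/ z = g 1 by exact: (AB z (conj Az Bz)).
    rewrite ginvK // /bB k1E k2E /aA !intrD !intrM; ring.
  rewrite ginvK // /bB l1E l2E /aA.
  have : (m1 * (l1 - k1) + m2 * (l2 - k2))%:~R = 0 :> R by rewrite mE.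
  by rewrite !intrD !intrM !intrB; lra.
have cpsi : {within K, continuous psi}.
  apply: withinU_continuous => //.
    apply: (@subspace_eq_continuous _ _ _ aA).
      by move=> z /set_mem Az; apply/esym/psiA.
    apply/subspace_continuousP => z Az.
    have /subspace_continuousP/(_ z Az) c1 := ca p1 p1in.
    have /subspace_continuousP/(_ z Az) c2 := ca p2 p2in.
    apply: cvgD; last exact: cvg_cst.
    by apply: cvgD; apply: cvgM => //; exact: cvg_cst.
  apply: compact_inv_continuous => //.
  apply: (@subspace_eq_continuous _ _ _ bB).
    by move=> t /set_mem; rewrite /= in_itv /= => t01; exact: esym (psiB t t01).
  apply/subspace_continuousP => t t01.
  have /subspace_continuousP/(_ t t01) c1 := cb1.
  have /subspace_continuousP/(_ t t01) c2 := cb2.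
  have /subspace_continuousP/(_ t t01) c3 := cb3.
  by apply: cvgD; (apply: cvgM; [exact: cvg_cst|exact: cvgB]).
have psiE z : K z -> exists k : int, psi z = m1%:~R * ang (z - p1) +
    m2%:~R * ang (z - p2) + (- (m1 + m2))%:~R * ang (z - p3) + k%:~R.
  move=> [Az|[t /=]].
    rewrite psiA // /aA /a.
    have [j1 ->] := crepE (ang (z - p1) - ang (z - p3)).
    have [j2 ->] := crepE (ang (z - p2) - ang (z - p3)).
    exists (m1 * j1 + m2 * j2 + (m1 * k1 + m2 * k2)).
    by rewrite !(intrD, intrN, intrM); ring.
  rewrite in_itv /= => t01 <-; rewrite psiB // /bB.
  have [j1 ->] := b1E t t01; have [j2 ->] := b2E t t01.
  have [j3 ->] := b3E t t01; exists (m1 * (j1 - j3) + m2 * (j2 - j3)).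
  by rewrite !(intrD, intrN, intrM, intrB); ring.
have coK : compact K by exact: compactU.
have [N [_ HN]] := compact_bounded (continuous_compact cpsi coK).
have N1 : 0 < `|N| + 1 by rewrite ltr_wpDl.
have [|Theta [TE cT _]] := continuous_bounded_extension pseudometric_normal cK N1 cpsi.
  move=> z Kz; apply: HN; last by exists z.
  by apply: le_lt_trans (ler_norm N) _; rewrite ltrDl.
have {}TE z : K z -> exists k : int, Theta z = m1%:~R * ang (z - p1) +
    m2%:~R * ang (z - p2) + (- (m1 + m2))%:~R * ang (z - p3) + k%:~R.
  by move=> Kz; rewrite -TE ?inE //; exact: psiE.
have [M M0 MK] := compact_l1_bound coK.
have far z : M <= `|z.1| \/ M <= `|z.2| -> (~` K) z.
  by move=> Mz /MK[]; case: Mz; lra.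
have bdd p : ~ C p (2 * M, 2 * M) ->
    forall z, connected_component (~` K) p z -> `|z.1| < M /\ `|z.2| < M.
  move=> Cp z pz.
  have H : ~ (M <= `|z.1| \/ M <= `|z.2|).
    move=> /(component_far M0 far) zM; apply: Cp.
    exact: connected_component_trans pz zM.
  by rewrite !ltNge; split; apply/negP => h; apply: H; [left|right].
apply: contrapT => H.
have n12 : ~ C p1 p2 by move=> h; apply: H; constructor 1.
have n13 : ~ C p1 p3 by move=> h; apply: H; constructor 2.
have n23 : ~ C p2 p3 by move=> h; apply: H; constructor 3.
have sym p q : ~ C p q -> ~ C q p by move=> h /connected_component_sym.
have z1 : ~ C p1 (2 * M, 2 * M) -> m1 = 0.
  move=> /bdd b; apply: (bounded_component_degree_eq0 (p' := p2) (p'' := p3)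
    cK cT _ _ _ _ _ b TE) => //; exact: Kp.
have z2 : ~ C p2 (2 * M, 2 * M) -> m2 = 0.
  move=> /bdd b; apply: (bounded_component_degree_eq0 (p' := p1) (p'' := p3)
    (m' := m1) (m'' := - (m1 + m2)) cK cT _ _ _ _ _ b) => //; try exact: Kp.
    exact: sym.
  by move=> z /TE[k ->]; exists k; ring.
have z3 : ~ C p3 (2 * M, 2 * M) -> m1 + m2 = 0.
  move=> /bdd b; apply: oppr_inj; rewrite oppr0.
  apply: (bounded_component_degree_eq0 (p' := p1) (p'' := p2)
    (m' := m1) (m'' := m2) cK cT _ _ _ _ _ b) => //; try exact: Kp.
  - exact: sym.
  - exact: sym.
  - by move=> z /TE[k ->]; exists k; ring.
have one p q : ~ C p q -> C p (2 * M, 2 * M) -> ~ C q (2 * M, 2 * M).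
  move=> pq pM /connected_component_sym qM; apply: pq.
  exact: connected_component_trans pM qM.
apply: m0.
have [c1|c1] := pselect (C p1 (2 * M, 2 * M)).
  have m20 := z2 (one _ _ n12 c1); have := z3 (one _ _ n13 c1).
  by rewrite m20 addr0.
have m10 := z1 c1; have [c2|c2] := pselect (C p2 (2 * M, 2 * M)).
  by have := z3 (one _ _ n23 c2); rewrite m10 add0r.
by rewrite (z2 c2).
Qed.
End TwoSides.

(** * The upper bound *)

Section UpperBound.
Local Open Scope classical_set_scope.
Local Open Scope ring_scope.
Variable R : realType.
Implicit Types (G H : plane_graph R) (v w : plane R) (f : set (plane R)).

Lemma jordan_arc_compact (e : set (plane R)) x y : jordan_arc e x y -> compact e.
Proof.
by move=> [g [cg _ _ _ <-]]; apply: continuous_compact cg _; exact: segment_compact.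
Qed.

Lemma edges_compact G e : edges G e -> compact e.
Proof. by move=> /edges_arc[x [y [/jordan_arc_compact]]]. Qed.

Lemma partial_drawing_compact G (F : set (set (plane R))) : F `<=` edges G ->
  compact ([set` vertices G] `|` \bigcup_(e in F) e).
Proof.
move=> FG; apply: compactU; first exact/finite_compact/finite_fset.
have /finite_fsetP[X XE] := sub_finite_set FG (edges_finite G).
rewrite XE bigcup_fset big_seq; apply: bigsetU_compact => e eX.
by apply: (@edges_compact G); apply: FG; rewrite XE.
Qed.

Lemma faces_on_edge G w f1 f2 f3 : drawing G w -> w \notin vertices G ->
  faces G f1 -> faces G f2 -> faces G f3 ->
  incident w f1 -> incident w f2 -> incident w f3 ->
  [\/ f1 = f2, f1 = f3 | f2 = f3].
Proof.
move=> Gw wV [q1 _ <-] [q2 _ <-] [q3 _ <-] i1 i2 i3.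
have [e Ge ew] : exists2 e, edges G e & e w.
  by case: Gw => [/= wV'|[e]]; [rewrite wV' in wV|exists e].
have [x [y [[g [cg ig g0 g1 ge]] eV]]] := edges_arc Ge.
pose A := [set` vertices G] `|` \bigcup_(e' in edges G `\ e) e'.
have coA : compact A by apply: partial_drawing_compact => e' [].
have cA : closed A by apply: compact_closed => //; exact: norm_hausdorff.
have GE : drawing G = A `|` g @` `[0, 1].
  rewrite ge /drawing /A -setUA; congr (_ `|` _); apply/seteqP; split => z.
    move=> [e' Ge' e'z]; have [ee|ee] := pselect (e' = e); first by right; rewrite -ee.
    by left; exists e'.
  by case=> [[e' [Ge' _] e'z]|ez]; [exists e'|exists e].
have Ae z : A z -> e z -> z \in vertices G.
  move=> [//|[e' [Ge' ee'] e'z]] ez.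
  by apply: (edges_disjoint Ge Ge'); [exact: nesym|split].
have wA : ~ A w by move=> /Ae /(_ ew); exact/negP.
have /nbhs_ballP[r /= r0 rA] : nbhs w (~` A).
  by apply: open_nbhs_nbhs; split => //; rewrite openC.
have r64 : 0 < r / 64 by lra.
have [p1 [c1 w1]] := i1 _ (nbhsx_ballx w _ r64).
have [p2 [c2 w2]] := i2 _ (nbhsx_ballx w _ r64).
have [p3 [c3 w3]] := i3 _ (nbhsx_ballx w _ r64).
rewrite (same_connected_component c1) (same_connected_component c2)
  (same_connected_component c3) GE.
have [|||h|h|h] := arc_two_sides (w := w) (p1 := p1) (p2 := p2) (p3 := p3) r0 coA cg ig.
- move=> z [Az]; rewrite ge g0 g1 => ez.
  by rewrite -eV; split => //; exact: Ae.
- exact: rA.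
- have pe p q : connected_component (~` drawing G) q p -> ~ (g @` `[0, 1]) p.
    by move=> /connected_component_sub + gp; apply; rewrite GE; right.
  move=> p; rewrite !inE => /or3P[] /eqP->; split => //;
    [exact: pe c1|exact: pe c2|exact: pe c3].
- by constructor 1; exact: same_connected_component.
- by constructor 2; exact: same_connected_component.
- by constructor 3; exact: same_connected_component.
Qed.

Lemma nat_maxP (A : set nat) (n : nat) : (forall a, A a -> (a <= n)%N) ->
  (forall a, A a -> (a <= nat_max A)%N) /\ (A !=set0 -> A (nat_max A)).
Proof.
move=> An; have [[a Aa]|A0] := pselect (A !=set0); last first.
  by split => // a Aa; case: A0; exists a.
have exA : exists a, `[< A a >] by exists a; apply/asboolP.
have bA b : `[< A b >] -> (b <= n)%N by move=> /asboolP; exact: An.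
suff H : A (nat_max A) /\ forall b, A b -> (b <= nat_max A)%N by case: H.
rewrite /nat_max; case: xgetP => [m _ //|].
have [m /asboolP Am maxm] := ex_maxnP exA bA.
by move=> /(_ m); case; split => // b /asboolP; exact: maxm.
Qed.

Lemma subdivision_vertices H G : subdivision H G -> (vertices H `<=` vertices G)%fset.
Proof.
elim=> [|G1 G2 _ IH]; first exact: fsubset_refl.
move=> [e [u [v [w [e1 [e2 [_ _ _ -> _]]]]]]].
exact: fsubset_trans IH (fsubsetU1 _ _).
Qed.

Lemma subdivision_drawing H G : subdivision H G -> drawing G = drawing H.
Proof. by elim=> // G1 G2 _ <- /subdivides_once_drawing. Qed.

Lemma excessE H G f : (vertices H `<=` vertices G)%fset ->
  (face_deg G f - face_deg H f)%N =
  #|` [fset v in vertices G | (v \notin vertices H) && `[< incident v f >]]%fset|.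
Proof.
move=> HG; rewrite /face_deg -cardfsDS; last first.
  apply/fsubsetP => v; rewrite !inE /= => /andP[/(fsubsetP HG) -> ->] //.
congr #|` _|; apply/fsetP => v; rewrite !inE /=.
case: (v \in vertices G) => /=; rewrite ?andbF //.
by case: (v \in vertices H); case: `[< _ >].
Qed.

Lemma excess_le_max H G f : subdivision H G -> faces G f ->
  (face_deg G f - face_deg H f <= max_excess H G)%N.
Proof.
move=> HG Gf.
have bd n : [set (face_deg G f - face_deg H f)%N | f in faces G] n ->
    (n <= #|` vertices G|)%N.
  move=> [f' _ <-]; rewrite excessE; last exact: subdivision_vertices.
  by apply/fsubset_leq_card/fsubsetP => v; rewrite !inE /= => /andP[].
by have [+ _] := nat_maxP bd; apply; exists f.
Qed.

Lemma chi_c_le G n : cyclic_colorable G n -> (chi_c G <= n)%N.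
Proof. by move=> Gn; rewrite /chi_c; case: ex_minnP => m _; apply; apply/asboolP. Qed.

Lemma chi_c_colorable G : cyclic_colorable G (chi_c G).
Proof. by rewrite /chi_c; case: ex_minnP => m /asboolP. Qed.

Lemma chi_c_subdivision H G : (0 < #|` vertices H|)%N -> subdivision H G ->
  (chi_c G <= (3 * max_excess H G) %/ 2 + chi_c H)%N.
Proof.
move=> H0 HG; apply: chi_c_le.
set k := max_excess H G.
have VHG := subdivision_vertices HG.
pose newv (v : vertices G) := (val v \notin vertices H) &&
  `[< exists2 f, faces G f & incident (val v) f >].
pose E := {v : vertices G | newv v}.
pose V := (set (plane R) + E)%type.
have choose_ends (e : E) : exists ab : V * V, [/\ ab.1 != ab.2,
    forall f, faces G f -> incident (val (val e)) f ->
      (inl f == ab.1) || (inl f == ab.2),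
    forall f, (inl f == ab.1) || (inl f == ab.2) ->
      faces G f /\ incident (val (val e)) f &
    forall e', (inr e' == ab.1) || (inr e' == ab.2) -> e' = e].

  case: e => v nv; have /andP[vH /asboolP[f Gf vf]] := nv.
  have [[f' [Gf' vf' ff']]|nf] :=
      pselect (exists f', [/\ faces G f', incident (val v) f' & f <> f']).
    exists (inl f, inl f'); split => //=.
    - by apply/eqP => -[].
    - move=> f2 Gf2 vf2; rewrite !(inj_eq inl_inj) !(eq_sym f2).
      rewrite (subdivision_faces HG) in Gf Gf' Gf2.
      have dv : drawing H (val v).
        by rewrite -(subdivision_drawing HG); left; exact: valP.
      have [//|->|->] := faces_on_edge dv vH Gf Gf' Gf2 vf vf' vf2.
      + by rewrite eqxx.
      + by rewrite eqxx orbT.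
    - by move=> f2 /orP[] /eqP[->].
  exists (inl f, inr (exist _ v nv)); split => //=.
  - move=> f2 Gf2 vf2; apply/orP; left; apply/eqP; congr inl.
    by apply: contrapT => ff2; apply: nf; exists f2; split => //; exact: nesym.
  - by move=> f2; rewrite orbF => /eqP[->].
  - by move=> e' /eqP[->].
have [ab abP] := choice choose_ends.
pose a e := (ab e).1; pose b e := (ab e).2.
have aNb e : a e != b e by have [] := abP e.
have endsl e f : faces G f -> incident (val (val e)) f -> ends a b e (inl f).
  move=> Gf ef; have [_ /(_ f Gf ef) + _ _] := abP e.
  by rewrite /ends !(eq_sym (inl f)).
have endsf e f : ends a b e (inl f) -> faces G f /\ incident (val (val e)) f.
  by have [_ _ + _] := abP e; move=> /(_ f); rewrite !(eq_sym (inl f)).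
have endsr e e' : ends a b e (inr e') -> e' = e.
  by have [_ _ _] := abP e; move=> /(_ e'); rewrite !(eq_sym (inr e')).
pose N f := [fset v in vertices G | (v \notin vertices H) && `[< incident v f >]]%fset.
have NP (e : E) f : incident (val (val e)) f -> val (val e) \in N f.
  move=> ef; have /andP[eH _] := valP e.
  by rewrite !inE /= eH; apply/and3P; split => //; exact/asboolP.
have Nk f : faces G f -> (#|` N f| <= k)%N.
  by move=> Gf; rewrite -excessE //; exact: excess_le_max.
have deg (x : V) : (#|[set e | ends a b e x]%SET| <= k)%N.
  case: x => [f|e'].
    have [->|/set0Pn[e0]] := eqVneq [set e | ends a b e (inl f)]%SET finset.set0.
      by rewrite cards0.
    rewrite inE => /endsf[Gf _]; apply: leq_trans (Nk f Gf).
    rewrite cardE -(size_map (fun e : E => val (val e))).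
    rewrite -[X in (_ <= X)%N]/(size (enum_fset (N f))).
    apply: uniq_leq_size.
      by rewrite map_inj_uniq ?enum_uniq // => e1 e2 /val_inj/val_inj.
    by move=> _ /mapP[e + ->]; rewrite mem_enum inE => /endsf[_ /NP].
  apply: (@leq_trans 1%N).
    rewrite -(cards1 e'); apply/subset_leq_card/fintype.subsetP => e.
    by rewrite !inE => /endsr ->.
  have /andP[_ /asboolP[f Gf ef]] := valP e'.
  apply: leq_trans (Nk f Gf); rewrite cardfs_gt0; apply/fset0Pn.
  by exists (val (val e')); exact: NP.
have [c1 c1P] := shannon aNb deg.
have [c0 c0P] := chi_c_colorable H.
have [u0 u0H] : exists u0 : vertices H, True.
  by move: H0; rewrite cardfs_gt0 => /fset0Pn[u uH]; exists [` uH]%fset.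
pose c (v : vertices G) : 'I_((3 * k) %/ 2 + chi_c H) :=
  if (insub (val v) : option (vertices H)) is Some u then rshift _ (c0 u)
  else if (insub v : option E) is Some e then lshift _ (c1 e)
  else rshift _ (c0 u0).
exists c => f Gf v w vw vf wf.
have inE' (x : vertices G) : val x \notin vertices H -> incident (val x) f -> newv x.
  by move=> xH xf; rewrite /newv xH; apply/asboolP; exists f.
have Hf : faces H f by rewrite -(subdivision_faces HG).
rewrite /c; case: (insubP _ (val v)) => [u uH uv|vH];
  case: (insubP _ (val w)) => [u' u'H u'w|wH].
- move=> /rshift_inj; apply: (c0P f Hf); rewrite ?uv ?u'w // => uu'.
  by apply: vw; apply: val_inj; rewrite -uv uu' u'w.
- by rewrite (insubT _ (inE' w wH wf)); apply/eqP; rewrite eq_rlshift.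
- by rewrite (insubT _ (inE' v vH vf)); apply/eqP; rewrite eq_lrshift.
- rewrite (insubT _ (inE' w wH wf)) (insubT _ (inE' v vH vf)) => /lshift_inj.
  apply/eqP; apply: (c1P _ _ (inl f)); rewrite ?inE //.
  + by apply/eqP => /(congr1 val).
  + exact: endsl.
  + exact: endsl.
Qed.
End UpperBound.

(** * Sharpness *)

Section Subdividing.
Local Open Scope classical_set_scope.
Local Open Scope ring_scope.
Variable R : realType.
Implicit Types (G H : plane_graph R) (u v w q : plane R) (e : set (plane R)).

Lemma plane_eq u v : u.1 = v.1 -> u.2 = v.2 -> u = v.
Proof. by case: u v => ? ? [? ?] /= -> ->. Qed.

Lemma seg_point_inj u v : u <> v -> injective (seg_point u v).
Proof.
move=> uv s t [/addrI h1 /addrI h2].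
have [d1|d1] := eqVneq (v.1 - u.1) 0; last by move: h1 => /(mulIf d1).
have [d2|d2] := eqVneq (v.2 - u.2) 0; last by move: h2 => /(mulIf d2).
by case: uv; apply: plane_eq; apply/eqP; rewrite eq_sym -subr_eq0 ?d1 ?d2.
Qed.

Lemma seg_jordan_arc u v : u <> v -> jordan_arc (seg u v) u v.
Proof.
move=> uv; exists (seg_point u v); split => //.
- exact/continuous_subspaceT/seg_point_continuous.
- by move=> s t _ _ /(seg_point_inj uv).
- exact: seg_point0.
- exact: seg_point1.
Qed.

Lemma jordan_arc_ends e u v : jordan_arc e u v -> [/\ e u, e v & u <> v].
Proof.
move=> [g [_ ig g0 g1 <-]]; split.
- by exists 0 => //; rewrite /= in_itv /= lexx ler01.
- by exists 1 => //; rewrite /= in_itv /= lexx ler01.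
- rewrite -g0 -g1 => /ig; rewrite !in_itv /= !lexx !ler01 => /(_ isT isT) /eqP.
  by rewrite eq_sym oner_eq0.
Qed.

Lemma split_edge G e u v w e1 e2 : edges G e -> e `&` [set` vertices G] = [set u; v] ->
  jordan_arc e u v -> jordan_arc e1 u w -> jordan_arc e2 w v ->
  e1 `|` e2 = e -> e1 `&` e2 = [set w] -> w \notin vertices G ->
  exists2 G', subdivides_once G G' &
    vertices G' = (w |` vertices G)%fset /\
    edges G' = (edges G `\ e) `|` [set e1; e2].
Proof.
move=> Ge eV eA e1A e2A e12 e12w wV.
pose E' := (edges G `\ e) `|` [set e1; e2].
pose V' := (w |` vertices G)%fset.
have V'P z : [set` V'] z <-> z = w \/ z \in vertices G.
  by rewrite /= in_fset1U; split => [/orP[/eqP|]|[->|->]]; rewrite ?eqxx ?orbT; auto.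
have E1 : e1 `<=` e by rewrite -e12; exact: subsetUl.
have E2 : e2 `<=` e by rewrite -e12; exact: subsetUr.
have [e1u e1w uw] := jordan_arc_ends e1A.
have [e2w e2v wv] := jordan_arc_ends e2A.
have [uV vV] : u \in vertices G /\ v \in vertices G.
  have : (e `&` [set` vertices G]) u by rewrite eV; left.
  have : (e `&` [set` vertices G]) v by rewrite eV; right.
  by move=> [_ ?] [_ ?].
have e1v : ~ e1 v.
  move=> h; have : (e1 `&` e2) v by []. by rewrite e12w /= => vw; case: wv.
have e2u : ~ e2 u.
  move=> h; have : (e1 `&` e2) u by []. by rewrite e12w /= => vw; case: uw.
have other e' : edges G e' -> e' <> e -> e' `&` e `<=` [set` vertices G].
  by move=> Ge' e'e; exact: edges_disjoint.
have fin : finite_set E'.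
  by rewrite finite_setU; split; [exact/finite_setD/edges_finite|exact: finite_set2].
have arcs e' : E' e' -> exists x y, jordan_arc e' x y /\ e' `&` [set` V'] = [set x; y].
  move=> [[Ge' e'e]|[->|->]].
  - have [x [y [e'A e'V]]] := edges_arc Ge'; exists x, y; split => //.
    rewrite -e'V; apply/seteqP; split => z [e'z].
      move=> /V'P[zw|//]; case/negP: wV; apply: (other e') => //.
      by split; rewrite -zw //; rewrite zw; exact: E1.
    by move=> zV; split => //; apply/V'P; right.
  - exists u, w; split => //; apply/seteqP; split => z.
      move=> [e1z /V'P[->|zV]]; first by right.
      have : (e `&` [set` vertices G]) z by split => //; exact: E1.
      by rewrite eV => -[->|zv]; [left|rewrite zv in e1z].
    by move=> [->|->]; split => //; apply/V'P; [right|left].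
  - exists w, v; split => //; apply/seteqP; split => z.
      move=> [e2z /V'P[->|zV]]; first by left.
      have : (e `&` [set` vertices G]) z by split => //; exact: E2.
      by rewrite eV => -[zu|->]; [rewrite zu in e2z|right].
    by move=> [->|->]; split => //; apply/V'P; [left|right].
have VV z : z \in vertices G -> [set` V'] z by move=> ?; apply/V'P; right.
have disj e' e'' : E' e' -> E' e'' -> e' <> e'' -> e' `&` e'' `<=` [set` V'].
  have new x : [set e1; e2] x -> x `<=` e by case=> ->.
  have mixed x y : (edges G `\ e) x -> [set e1; e2] y -> x `&` y `<=` [set` V'].
    move=> [Gx xe] /new ye z [xz yz].
    by apply: VV; apply: (other x) => //; split => //; exact: ye.
  move=> [he'|he'] [he''|he''] ne.
  - by move=> z ez; apply: VV; apply: edges_disjoint ez; [case: he'|case: he''|].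
  - exact: mixed.
  - by rewrite setIC; exact: mixed.
  - suff -> : e' `&` e'' = [set w] by move=> z ->; apply/V'P; left.
    by move: he' he'' ne => [->|->] [->|->] //; rewrite setIC.
exists (PlaneGraph fin arcs disj) => //.
by exists e, u, v, w, e1, e2; split.
Qed.

Definition mid q : plane R := seg_point 0 q 2^-1.

Lemma mid_neq0 q : q <> 0 -> mid q <> 0.
Proof.
move=> q0; rewrite -(seg_point0 0 q) => /seg_point_inj h.
by have /eqP := h (nesym q0); rewrite invr_eq0 pnatr_eq0.
Qed.

Lemma mid_split q : q <> 0 ->
  seg 0 (mid q) `|` seg (mid q) q = seg 0 q /\
  seg 0 (mid q) `&` seg (mid q) q = [set mid q].
Proof.
move=> q0.
have s1 t : seg_point 0 (mid q) t = seg_point 0 q (t / 2).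
  by apply: plane_eq => /=; ring.
have s2 t : seg_point (mid q) q t = seg_point 0 q ((t + 1) / 2).
  by apply: plane_eq; rewrite /mid /seg_point /=; field.
have itvP (t : R) : `[0 : R, 1]%classic t -> 0 <= t /\ t <= 1.
  by rewrite /= in_itv /= => /andP.
have itvI (t : R) : 0 <= t -> t <= 1 -> `[0 : R, 1]%classic t.
  by move=> t0 t1; rewrite /= in_itv /= t0.
split; apply/seteqP; split => z.
- move=> [] [t /itvP[t0 t1] <-].
    by rewrite s1; exists (t / 2) => //; apply: itvI; lra.
  by rewrite s2; exists ((t + 1) / 2) => //; apply: itvI; lra.
- move=> [t /itvP[t0 t1] <-].
  have [h|h] := lerP t 2^-1.
    by left; exists (t * 2); [apply: itvI; lra|rewrite s1 mulfK ?pnatr_eq0].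
  by right; exists (t * 2 - 1); [apply: itvI; lra|rewrite s2 subrK mulfK ?pnatr_eq0].
- move=> [[t /itvP[t0 t1] <-] [s /itvP[s0 s1']]].
  rewrite s1 s2 => /(seg_point_inj (nesym q0)) h.
  by rewrite /mid; congr seg_point; lra.
- by move=> ->; split; [exact: seg_right|exact: seg_left].
Qed.

Lemma subdivide_spoke n G q : q <> 0 -> edges G (seg 0 q) ->
  0 \in vertices G -> q \in vertices G ->
  exists G' (A : {fset plane R}),
    [/\ forall H, subdivision H G -> subdivision H G',
        vertices G' = (vertices G `|` A)%fset /\
          #|` vertices G'| = (#|` vertices G| + n)%N,
        (#|` A| <= n)%N,
        forall v, v \in A -> exists2 t : R, 0 < t < 1 & v = seg_point 0 q t &
        forall e, edges G e -> e <> seg 0 q -> edges G' e].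
Proof.
elim: n G q => [|n IH] G q q0 Gq V0 Vq.
  by exists G, fset0; split; rewrite ?fsetU0 ?addn0 ?cardfs0.
have qq := seg_jordan_arc (nesym q0).
have mq0 := mid_neq0 q0.
have mqq : mid q <> q.
  move=> h; have : seg_point 0 q 2^-1 = seg_point 0 q 1 by rewrite seg_point1.
  by move=> /(seg_point_inj (nesym q0)); lra.
have [sU sI] := mid_split q0.
have smid : seg 0 q (mid q) by rewrite -sU; left; exact: seg_right.
have eV : seg 0 q `&` [set` vertices G] = [set 0; q].
  have [x [y [_ xy]]] := edges_arc Gq.
  have h0 : [set x; y] 0 by rewrite -xy; split => //; exact: seg_left.
  have hq : [set x; y] q by rewrite -xy; split => //; exact: seg_right.
  case: h0 => h0; case: hq => hq; rewrite xy.
  - by case: q0; rewrite hq h0.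
  - by rewrite h0 hq.
  - by rewrite h0 hq setUC.
  - by case: q0; rewrite hq h0.
have wV : mid q \notin vertices G.
  apply/negP => wV; have : (seg 0 q `&` [set` vertices G]) (mid q) by split.
  by rewrite eV => -[].
have [G1 GG1 [V1 E1]] := split_edge Gq eV qq (seg_jordan_arc (nesym mq0))
  (seg_jordan_arc mqq) sU sI wV.
have [||||G' [A [sG' [VG' cG'] cA At eG']]] := IH G1 (mid q) => //.
- by rewrite E1; right; left.
- by rewrite V1 in_fset1U V0 orbT.
- by rewrite V1 in_fset1U eqxx.
exists G', (mid q |` A)%fset; split.
- by move=> H HG; apply: sG'; apply: subdivision_step HG GG1.
- split; first by rewrite VG' V1 fsetUCA fsetUA.
  by rewrite cG' V1 cardfsU1 wV add1n addnS addSn.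
- by rewrite cardfsU1; case: (_ \notin _) => /=; rewrite ?add1n ?add0n // ltnW.
- move=> v; rewrite in_fset1U => /orP[/eqP->|/At[t t01 ->]].
    by exists 2^-1 => //; apply/andP; split; lra.
  exists (t / 2); first by case/andP: t01 => ? ?; apply/andP; split; lra.
  by apply: plane_eq => /=; ring.
- move=> e Ge eq; apply: eG'; first by rewrite E1; left.
  move=> es; case/negP: wV.
  apply: (edges_disjoint Ge Gq eq); split => //.
  by rewrite es; exact: seg_right.
Qed.
End Subdividing.

Section Triangles.
Local Open Scope classical_set_scope.
Local Open Scope ring_scope.
Variable R : realType.
Implicit Types (l : R * R * R) (x y z : plane R).

Definition lev l z : R := l.1.1 * z.1 + l.1.2 * z.2 + l.2.

Lemma lev_continuous l : continuous (lev l).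
Proof.
move=> z; apply: cvgD; last exact: cvg_cst.
by apply: cvgD; (apply: cvgM; [exact: cvg_cst|]); [exact: cvg_fst|exact: cvg_snd].
Qed.

Lemma lev_seg_point l x y (t : R) :
  lev l (seg_point x y t) = (1 - t) * lev l x + t * lev l y.
Proof. by rewrite /lev /seg_point /=; ring. Qed.

Definition open_tri (L : R * R * R * (R * R * R) * (R * R * R)) : set (plane R) :=
  [set z | [/\ 0 < lev L.1.1 z, 0 < lev L.1.2 z & 0 < lev L.2 z]].

Definition closed_tri (L : R * R * R * (R * R * R) * (R * R * R)) : set (plane R) :=
  [set z | [/\ 0 <= lev L.1.1 z, 0 <= lev L.1.2 z & 0 <= lev L.2 z]].

Variable L : R * R * R * (R * R * R) * (R * R * R).

Lemma open_tri_open : open (open_tri L).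
Proof.
have -> : open_tri L = lev L.1.1 @^-1` [set r | 0 < r] `&`
    lev L.1.2 @^-1` [set r | 0 < r] `&` lev L.2 @^-1` [set r | 0 < r].
  by apply/seteqP; split => z; [case|case=> -[]].
have o l : open (lev l @^-1` [set r | 0 < r]).
  by have /continuousP := @lev_continuous l; apply; exact: open_gt.
by apply: openI => //; exact: openI.
Qed.

Lemma closed_tri_closed : closed (closed_tri L).
Proof.
have -> : closed_tri L = lev L.1.1 @^-1` [set r | 0 <= r] `&`
    lev L.1.2 @^-1` [set r | 0 <= r] `&` lev L.2 @^-1` [set r | 0 <= r].
  by apply/seteqP; split => z; [case|case=> -[]].
have o l : closed (lev l @^-1` [set r | 0 <= r]).
  by have /continuous_closedP := @lev_continuous l; apply; exact: closed_ge.
by apply: closedI => //; exact: closedI.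
Qed.

Lemma open_tri_sub : open_tri L `<=` closed_tri L.
Proof. by move=> z [h1 h2 h3]; split; exact: ltW. Qed.

Lemma open_tri_seg x y (t : R) : closed_tri L x -> open_tri L y -> 0 < t <= 1 ->
  open_tri L (seg_point x y t).
Proof.
move=> [x1 x2 x3] [y1 y2 y3] /andP[t0 t1].
have pos (a b : R) : 0 <= a -> 0 < b -> 0 < (1 - t) * a + t * b.
  move=> a0 b0; rewrite ltr_wpDl ?mulr_gt0 // mulr_ge0 // subr_ge0.
  exact: t1.
by split; rewrite lev_seg_point; exact: pos.
Qed.

Lemma closure_open_tri x z : open_tri L x ->
  closure (open_tri L) z <-> closed_tri L z.
Proof.
move=> Lx; split => [Cz|Lz].
  have /closure_id -> := closed_tri_closed; apply: closure_subset Cz.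
  exact: open_tri_sub.
move=> B zB.
have : \forall t \near (0 : R), B (seg_point z x t).
  by apply: (@seg_point_continuous _ z x 0); rewrite seg_point0.
move=> /nbhs_ballP[r /= r0 rB].
pose t := Num.min (r / 2) 1.
have t0 : 0 < t by rewrite lt_min ltr01 andbT; lra.
exists (seg_point z x t); split.
  by apply: open_tri_seg => //; rewrite t0 ge_min lexx orbT.
apply: rB; rewrite /ball /= sub0r normrN gtr0_norm // gt_min.
by apply/orP; left; lra.
Qed.

Lemma component_open_tri (K : set (plane R)) z :
  open_tri L `<=` ~` K -> closed_tri L `&` ~` K `<=` open_tri L ->
  open_tri L z -> connected_component (~` K) z = open_tri L.
Proof.
move=> LK KL Lz; apply/seteqP; split => [y zy|y Ly].
  set C := connected_component (~` K) z in zy.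
  have CK : C `<=` ~` K by exact: connected_component_sub.
  have : C `&` open_tri L = C.
    apply: (@component_connected _ (~` K) z).
    - by exists z; split => //; apply: connected_component_refl; exact: LK.
    - by exists (open_tri L) => //; exact: open_tri_open.
    - exists (closed_tri L); first exact: closed_tri_closed.
      apply/seteqP; split => u [Cu Lu]; split => //; first exact: open_tri_sub.
      by apply: KL; split => //; exact: CK.
  by move=> CE; move: zy; rewrite -CE => -[].
apply: (@component_seg _ _ _ z); first exact/connected_component_refl/LK.
apply: subset_trans LK => u [t /=]; rewrite in_itv /= => /andP[t0 t1] <-.
have [->|tn0] := eqVneq t 0; first by rewrite seg_point0.
apply: open_tri_seg => //; first exact: open_tri_sub.
by rewrite lt0r tn0 t0.
Qed.
End Triangles.

Section Tightness.
Local Open Scope classical_set_scope.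
Local Open Scope ring_scope.
Variable R : realType.
Implicit Types (G H : plane_graph R) (u v w z : plane R).

Definition pa : plane R := (1, 0).
Definition pb : plane R := (0, 1).
Definition pc : plane R := (-1, -1).

(* The three edges at 0 are those to be subdivided. *)
Definition K4_vertices : {fset plane R} := (0 |` (pa |` (pb |` [fset pc])))%fset.
Definition K4_edges : set (set (plane R)) :=
  [set` [:: seg 0 pa; seg 0 pb; seg 0 pc; seg pa pb; seg pb pc; seg pc pa]].

Lemma segP u v z : seg u v z <-> exists t : R,
  [/\ 0 <= t, t <= 1, z.1 = u.1 + t * (v.1 - u.1) & z.2 = u.2 + t * (v.2 - u.2)].
Proof.
split=> [[t /=]|[t [t0 t1 z1 z2]]].
  by rewrite in_itv /= => /andP[t0 t1] <-; exists t.
by exists t; [rewrite /= in_itv /= t0|apply: plane_eq].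
Qed.

Lemma K4_verticesP z : z \in K4_vertices <->
  [\/ z.1 = 0 /\ z.2 = 0, z.1 = 1 /\ z.2 = 0, z.1 = 0 /\ z.2 = 1
    | z.1 = -1 /\ z.2 = -1].
Proof.
rewrite !inE; split.
  by move=> /or4P[] /eqP->; [constructor 1|constructor 2|constructor 3|constructor 4].
move=> H; apply/or4P; case: H => -[h1 h2].
- by constructor 1; apply/eqP/plane_eq.
- by constructor 2; apply/eqP/plane_eq.
- by constructor 3; apply/eqP/plane_eq.
- by constructor 4; apply/eqP/plane_eq.
Qed.

Lemma K4_edgesP e : K4_edges e <-> [\/ e = seg 0 pa, e = seg 0 pb | e = seg 0 pc] \/
  [\/ e = seg pa pb, e = seg pb pc | e = seg pc pa].
Proof.
rewrite /K4_edges /= !inE; split.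
  case/orP => [/eqP->|]; first by left; constructor 1.
  case/orP => [/eqP->|]; first by left; constructor 2.
  case/orP => [/eqP->|]; first by left; constructor 3.
  case/orP => [/eqP->|]; first by right; constructor 1.
  case/orP => /eqP->; first by right; constructor 2.
  by right; constructor 3.
by move=> [[]|[]] ->; rewrite eqxx ?orbT.
Qed.

Lemma K4_points_neq : [/\ (0 : plane R) <> pa, (0 : plane R) <> pb,
  (0 : plane R) <> pc & [/\ pa <> pb, pb <> pc & pc <> pa]].
Proof.
split; last split.
all: by move=> h; have := congr1 fst h; have := congr1 snd h => /=; lra.
Qed.

Ltac seg_coords := move=> /segP[? [? ? /= ? ?]].

Lemma K4_arc e : K4_edges e -> exists x y,
  jordan_arc e x y /\ e `&` [set` K4_vertices] = [set x; y].
Proof.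
have [oa ob oc [ab bc ca]] := K4_points_neq.
have E u v : u <> v -> u \in K4_vertices -> v \in K4_vertices ->
    (forall z, seg u v z -> z \in K4_vertices -> z = u \/ z = v) ->
    exists x y, jordan_arc (seg u v) x y /\
      seg u v `&` [set` K4_vertices] = [set x; y].
  move=> uv uV vV H; exists u, v; split; first exact: seg_jordan_arc.
  apply/seteqP; split => z; first by case=> sz /= zV; exact: H.
  by case=> ->; split => //; [exact: seg_left|exact: seg_right].
have V0 : 0 \in K4_vertices by apply/K4_verticesP; constructor 1.
have Va : pa \in K4_vertices by apply/K4_verticesP; constructor 2.
have Vb : pb \in K4_vertices by apply/K4_verticesP; constructor 3.
have Vc : pc \in K4_vertices by apply/K4_verticesP; constructor 4.
by move=> /K4_edgesP[[]|[]] ->; apply: E => // z; seg_coords;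
  move=> /K4_verticesP[] [? ?];
  first [left; apply: plane_eq => /=; lra | right; apply: plane_eq => /=; lra
        | exfalso; lra].
Qed.

Lemma K4_disjoint e e' : K4_edges e -> K4_edges e' -> e <> e' ->
  e `&` e' `<=` [set` K4_vertices].
Proof.
by move=> /K4_edgesP[[]|[]] -> /K4_edgesP[[]|[]] -> // _ z []; seg_coords;
  seg_coords; apply/K4_verticesP;
  first [constructor 1; split; lra | constructor 2; split; lra
        | constructor 3; split; lra | constructor 4; split; lra].
Qed.

Definition K4 : plane_graph R :=
  PlaneGraph (finite_seq _) K4_arc K4_disjoint.

Lemma K4_card : #|` vertices K4| = 4%N.
Proof.
have [oa ob oc [ab bc ca]] := K4_points_neq.

rewrite /= /K4_vertices !cardfsU1 !inE cardfs1.
move/eqP/negbTE: oa => ->; move/eqP/negbTE: ob => ->; move/eqP/negbTE: oc => ->.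
move/eqP/negbTE: ab => ->; move/eqP/negbTE: bc => ->.
by move/nesym/eqP/negbTE: ca => ->.
Qed.

Lemma K4_k_connected : k_connected 3 K4.
Proof.
split; first by rewrite K4_card.
move=> X _ _ v w vX wX; have [->|vw] := eqVneq v w; first exact: connect0.
apply: connect1; rewrite /= vX wX /=; apply/asboolP; split.
  by move=> /val_inj /eqP; exact/negP.
have key x y : K4_edges (seg x y) -> (exists2 e, K4_edges e & e x /\ e y) /\
    (exists2 e, K4_edges e & e y /\ e x).
  move=> exy; split; exists (seg x y) => //; split;
  by [exact: seg_left|exact: seg_right].
have [[k1 k1'] [k2 k2'] [k3 k3'] [[k4 k4'] [k5 k5'] [k6 k6']]] :
  [/\ (exists2 e, K4_edges e & e 0 /\ e pa) /\ (exists2 e, K4_edges e & e pa /\ e 0),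
      (exists2 e, K4_edges e & e 0 /\ e pb) /\ (exists2 e, K4_edges e & e pb /\ e 0),
      (exists2 e, K4_edges e & e 0 /\ e pc) /\ (exists2 e, K4_edges e & e pc /\ e 0) &
  [/\ (exists2 e, K4_edges e & e pa /\ e pb) /\ (exists2 e, K4_edges e & e pb /\ e pa),
      (exists2 e, K4_edges e & e pb /\ e pc) /\ (exists2 e, K4_edges e & e pc /\ e pb) &
      (exists2 e, K4_edges e & e pc /\ e pa) /\ (exists2 e, K4_edges e & e pa /\ e pc)]].
  split; [| | |split]; apply: key; apply/K4_edgesP.
  - by left; constructor 1.
  - by left; constructor 2.
  - by left; constructor 3.
  - by right; constructor 1.
  - by right; constructor 2.
  - by right; constructor 3.
have neq : val v <> val w by move=> /val_inj /eqP; exact/negP.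
move: (fsvalP v) (fsvalP w) neq; rewrite /= !inE.
by move=> /or4P[] /eqP-> /or4P[] /eqP->.
Qed.

(* The inner faces, each given by the affine functions positive on it. *)
Definition tri_ab : R * R * R * (R * R * R) * (R * R * R) :=
  ((1, 0, 0), (0, 1, 0), (-1, -1, 1)).
Definition tri_bc : R * R * R * (R * R * R) * (R * R * R) :=
  ((-1, 0, 0), (-1, 1, 0), (2, -1, 1)).
Definition tri_ca : R * R * R * (R * R * R) * (R * R * R) :=
  ((0, -1, 0), (1, -1, 0), (-1, 2, 1)).

Lemma K4_drawingP z : drawing K4 z <->
  [\/ seg 0 pa z, seg 0 pb z | seg 0 pc z] \/
  [\/ seg pa pb z, seg pb pc z | seg pc pa z].
Proof.
split=> [[/=|[e /K4_edgesP He ez]]|].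
- rewrite !inE => /or4P[] /eqP->.
  + by left; constructor 1; exact: seg_left.
  + by left; constructor 1; exact: seg_right.
  + by left; constructor 2; exact: seg_right.
  + by left; constructor 3; exact: seg_right.
- case: He => [[]|[]] ee; rewrite ee in ez.
  + by left; constructor 1.
  + by left; constructor 2.
  + by left; constructor 3.
  + by right; constructor 1.
  + by right; constructor 2.
  + by right; constructor 3.
- have E e : K4_edges e -> e z -> drawing K4 z by move=> Ke ez; right; exists e.
  case=> [[]|[]]; apply: E; apply/K4_edgesP.
  + by left; constructor 1.
  + by left; constructor 2.
  + by left; constructor 3.
  + by right; constructor 1.
  + by right; constructor 2.
  + by right; constructor 3.
Qed.

Definition inner_tri L := L \in [:: tri_ab; tri_bc; tri_ca].

Lemma inner_triP L : inner_tri L -> [\/ L = tri_ab, L = tri_bc | L = tri_ca].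
Proof.
by rewrite /inner_tri !inE => /or3P[] /eqP; [constructor 1|constructor 2|constructor 3].
Qed.

Lemma inner_tri_disjoint L : inner_tri L -> open_tri L `<=` ~` drawing K4.
Proof.
by move=> /inner_triP[] -> z; rewrite /open_tri /lev /= => -[? ? ?] /K4_drawingP[[]|[]];
  seg_coords; lra.
Qed.

Lemma inner_tri_boundary L : inner_tri L ->
  closed_tri L `&` ~` drawing K4 `<=` open_tri L.
Proof.
have ne (z : plane R) (r : R) : 0 <= r -> ~ drawing K4 z ->
    (r = 0 -> drawing K4 z) -> 0 < r.
  by move=> r0 nz rz; rewrite lt0r r0 andbT; apply/eqP => /rz.
have s (u v z : plane R) t : 0 <= t -> t <= 1 -> z.1 = u.1 + t * (v.1 - u.1) ->
    z.2 = u.2 + t * (v.2 - u.2) -> seg u v z by move=> *; apply/segP; exists t.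
move=> /inner_triP[] -> z; rewrite /open_tri /closed_tri /lev /= => -[[h1 h2 h3] Kz].
- split; apply: (ne z) => // h; apply/K4_drawingP.
  + by left; constructor 2; apply: (s _ _ _ z.2) => /=; lra.
  + by left; constructor 1; apply: (s _ _ _ z.1) => /=; lra.
  + by right; constructor 1; apply: (s _ _ _ z.2) => /=; lra.
- split; apply: (ne z) => // h; apply/K4_drawingP.
  + by left; constructor 2; apply: (s _ _ _ z.2) => /=; lra.
  + by left; constructor 3; apply: (s _ _ _ (- z.1)) => /=; lra.
  + by right; constructor 2; apply: (s _ _ _ (- z.1)) => /=; lra.
- split; apply: (ne z) => // h; apply/K4_drawingP.
  + by left; constructor 1; apply: (s _ _ _ z.1) => /=; lra.
  + by left; constructor 3; apply: (s _ _ _ (- z.1)) => /=; lra.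
  + by right; constructor 3; apply: (s _ _ _ (z.2 + 1)) => /=; lra.
Qed.

Lemma inner_tri_component L z : inner_tri L -> open_tri L z ->
  connected_component (~` drawing K4) z = open_tri L.
Proof.
move=> iL; apply: component_open_tri; first exact: inner_tri_disjoint.
exact: inner_tri_boundary.
Qed.

Lemma inner_tri_point L : inner_tri L -> exists z, open_tri L z.
Proof.
move=> /inner_triP[] ->.
- by exists (4^-1, 4^-1); split; rewrite /lev /=; lra.
- by exists (- 4^-1, 0); split; rewrite /lev /=; lra.
- by exists (0, - 4^-1); split; rewrite /lev /=; lra.
Qed.

Lemma inner_tri_face L : inner_tri L -> faces K4 (open_tri L).
Proof.
move=> iL; have [z Lz] := inner_tri_point iL; exists z.
  exact: inner_tri_disjoint Lz.
exact: inner_tri_component.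
Qed.

Lemma inner_tri_incident L v : inner_tri L ->
  incident v (open_tri L) <-> closed_tri L v.
Proof. by move=> iL; have [z Lz] := inner_tri_point iL; exact: closure_open_tri Lz. Qed.

Lemma incident_inside v f : faces K4 f -> incident v f ->
  v.1 + v.2 < 1 -> v.2 < 2 * v.1 + 1 -> v.1 < 2 * v.2 + 1 ->
  exists2 L, inner_tri L & f = open_tri L /\ closed_tri L v.
Proof.
move=> [q _ <-] vf h1 h2 h3.
pose D : R * R * R * (R * R * R) * (R * R * R) :=
  ((-1, -1, 1), (2, -1, 1), (-1, 2, 1)).
have Dv : nbhs v (open_tri D).
  apply: open_nbhs_nbhs; split; first exact: open_tri_open.
  by split; rewrite /lev /=; lra.
have [z [qz]] := vf _ Dv; rewrite /open_tri /lev /= => -[d1 d2 d3].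
have Kz : ~ drawing K4 z by exact: connected_component_sub qz.
have [L iL Lz] : exists2 L, inner_tri L & closed_tri L z.
  have [x0|x0] := lerP 0 z.1; have [y0|y0] := lerP 0 z.2.
  - by exists tri_ab; [rewrite /inner_tri !inE eqxx|split; rewrite /lev /=; lra].
  - by exists tri_ca; [rewrite /inner_tri !inE eqxx ?orbT|split; rewrite /lev /=; lra].
  - by exists tri_bc; [rewrite /inner_tri !inE eqxx ?orbT|split; rewrite /lev /=; lra].
  - have [xy|xy] := lerP z.1 z.2.
      by exists tri_bc; [rewrite /inner_tri !inE eqxx ?orbT|split; rewrite /lev /=; lra].
    by exists tri_ca; [rewrite /inner_tri !inE eqxx ?orbT|split; rewrite /lev /=; lra].
have oLz : open_tri L z by exact: inner_tri_boundary.
have fE : connected_component (~` drawing K4) q = open_tri L.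
  by rewrite (same_connected_component qz) (inner_tri_component iL).
exists L => //; split => //.
by apply/(inner_tri_incident _ iL); rewrite -fE.
Qed.
End Tightness.

Section Sharpness.
Local Open Scope classical_set_scope.
Local Open Scope ring_scope.
Variable R : realType.
Implicit Types (G H : plane_graph R) (v : plane R).

Lemma spokes_neq : [/\ seg 0 (pb R) <> seg 0 (pa R), seg 0 (pc R) <> seg 0 (pa R) &
  seg 0 (pc R) <> seg 0 (pb R)].
Proof.
have N (p q : plane R) : ~ seg 0 q p -> seg 0 p <> seg 0 q.
  by move=> n E; apply: n; rewrite -E; exact: seg_right.
by split; apply: N => /segP[t [? ? /= ? ?]]; lra.
Qed.

Lemma chi_c_ge_clique G :
  (forall v w, v \in vertices G -> w \in vertices G -> v <> w ->
     exists f, [/\ faces G f, incident v f & incident w f]) ->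
  (#|` vertices G| <= chi_c G)%N.
Proof.
move=> clique; have [c cP] := chi_c_colorable G.
rewrite cardfE -[X in (_ <= X)%N]card_ord; apply: (@leq_card _ _ c) => v w cvw.
apply: contrapT => vw; have [|f [Gf vf wf]] := clique _ _ (fsvalP v) (fsvalP w).
  by move=> /val_inj.
exact: cP Gf v w vw vf wf cvw.
Qed.

Lemma chi_c_le_card G : (chi_c G <= #|` vertices G|)%N.
Proof.
apply: chi_c_le; rewrite cardfE; exists enum_rank.
by move=> f _ v w vw _ _ /enum_rank_inj.
Qed.

Lemma subdivided_K4 (i j l : nat) : exists G (A B C : {fset plane R}),
  [/\ subdivision (K4 R) G,
      vertices G = (vertices (K4 R) `|` A `|` B `|` C)%fset /\
        #|` vertices G| = (4 + i + j + l)%N,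
      [/\ (#|` A| <= i)%N, (#|` B| <= j)%N & (#|` C| <= l)%N] &
      [/\ forall v, v \in A -> exists2 t : R, 0 < t < 1 & v = (t, 0),
          forall v, v \in B -> exists2 t : R, 0 < t < 1 & v = (0, t) &
          forall v, v \in C -> exists2 t : R, 0 < t < 1 & v = (- t, - t)]].
Proof.
have [oa ob oc _] := K4_points_neq R; have [ba ca cb] := spokes_neq.
have V0 : 0 \in vertices (K4 R) by apply/K4_verticesP; constructor 1.
have Va : pa R \in vertices (K4 R) by apply/K4_verticesP; constructor 2.
have Vb : pb R \in vertices (K4 R) by apply/K4_verticesP; constructor 3.
have Vc : pc R \in vertices (K4 R) by apply/K4_verticesP; constructor 4.
have Ea : edges (K4 R) (seg 0 (pa R)) by apply/K4_edgesP; left; constructor 1.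
have Eb : edges (K4 R) (seg 0 (pb R)) by apply/K4_edgesP; left; constructor 2.
have Ec : edges (K4 R) (seg 0 (pc R)) by apply/K4_edgesP; left; constructor 3.
have [G1 [A [s1 [V1 c1] cA At e1]]] := subdivide_spoke i (nesym oa) Ea V0 Va.
have V01 : 0 \in vertices G1 by rewrite V1 in_fsetU V0.
have Vb1 : pb R \in vertices G1 by rewrite V1 in_fsetU Vb.
have [G2 [B [s2 [V2 c2] cB Bt e2]]] :=
  subdivide_spoke j (nesym ob) (e1 _ Eb ba) V01 Vb1.
have V02 : 0 \in vertices G2 by rewrite V2 in_fsetU V01.
have Vc2 : pc R \in vertices G2 by rewrite V2 in_fsetU V1 in_fsetU Vc.
have [G3 [C [s3 [V3 c3] cC Ct _]]] :=
  subdivide_spoke l (nesym oc) (e2 _ (e1 _ Ec ca) cb) V02 Vc2.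
exists G3, A, B, C; split.
- by apply/s3/s2/s1; exact: subdivision_refl.
- by rewrite c3 c2 c1 K4_card V3 V2 V1.
- by [].
- split => v.
  + by move=> /At[t t01 ->]; exists t => //; apply: plane_eq => /=; ring.
  + by move=> /Bt[t t01 ->]; exists t => //; apply: plane_eq => /=; ring.
  + by move=> /Ct[t t01 ->]; exists t => //; apply: plane_eq => /=; ring.
Qed.

Lemma sharp_arith (k m x h : nat) : (4 + (3 * k) %/ 2 <= x)%N ->
  (x <= (3 * m) %/ 2 + h)%N -> (h <= 4)%N -> (m <= k)%N ->
  m = k /\ x = ((3 * m) %/ 2 + h)%N.
Proof. by lia. Qed.

Lemma halves (k : nat) : [/\ (uphalf k + k./2 <= k)%N, (k./2 + k./2 <= k)%N &
  (4 + (3 * k) %/ 2 = 4 + uphalf k + k./2 + k./2)%N].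
Proof. by split; lia. Qed.

Lemma bound_sharp (k : nat) : exists H G : plane_graph R,
  [/\ k_connected 3 H, subdivision H G, max_excess H G = k &
      chi_c G = ((3 * max_excess H G) %/ 2 + chi_c H)%N].
Proof.
have [kud kdd k32] := halves k.
have [G [A [B [C [KG [VG cG] [cA cB cC] [At Bt Ct]]]]]] :=
  subdivided_K4 (uphalf k) k./2 k./2.
exists (K4 R), G.
have iab : inner_tri (tri_ab R) by rewrite /inner_tri !inE eqxx.
have ibc : inner_tri (tri_bc R) by rewrite /inner_tri !inE eqxx orbT.
have ica : inner_tri (tri_ca R) by rewrite /inner_tri !inE eqxx !orbT.
have two v : v \in vertices G ->
    [\/ closed_tri (tri_ab R) v /\ closed_tri (tri_bc R) v,
        closed_tri (tri_ab R) v /\ closed_tri (tri_ca R) v |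
        closed_tri (tri_bc R) v /\ closed_tri (tri_ca R) v].
  rewrite VG 3!in_fsetU -!orbA => /or4P[/K4_verticesP[] [h1 h2]|/At[t /andP[t0 t1] ->]|
    /Bt[t /andP[t0 t1] ->]|/Ct[t /andP[t0 t1] ->]].
  - by constructor 1; split; split; rewrite /lev /=; lra.
  - by constructor 2; split; split; rewrite /lev /=; lra.
  - by constructor 1; split; split; rewrite /lev /=; lra.
  - by constructor 3; split; split; rewrite /lev /=; lra.
  - by constructor 2; split; split; rewrite /lev /=; lra.
  - by constructor 1; split; split; rewrite /lev /=; lra.
  - by constructor 3; split; split; rewrite /lev /=; lra.
have clique v w : v \in vertices G -> w \in vertices G -> v <> w ->
    exists f, [/\ faces G f, incident v f & incident w f].
  move=> /two tv /two tw _.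
  have [L iL [Lv Lw]] : exists2 L, inner_tri L & closed_tri L v /\ closed_tri L w.
    by case: tv => -[? ?]; case: tw => -[? ?];
     first [exists (tri_ab R); [exact: iab|split; assumption]
           |exists (tri_bc R); [exact: ibc|split; assumption]
           |exists (tri_ca R); [exact: ica|split; assumption]].
  exists (open_tri L); rewrite (subdivision_faces KG); split.
  - exact: inner_tri_face.
  - exact/inner_tri_incident.
  - exact/inner_tri_incident.
have low : (4 + (3 * k) %/ 2 <= chi_c G)%N.
  by apply: leq_trans (chi_c_ge_clique clique); rewrite cG k32.
have up := chi_c_subdivision _ KG; rewrite K4_card in up; have {}up := up isT.
have four : (chi_c (K4 R) <= 4)%N by rewrite -(K4_card R) chi_c_le_card.
have mk : (max_excess (K4 R) G <= k)%N.
  have bd n : [set (face_deg G f - face_deg (K4 R) f)%N | f in faces G] n -> (n <= k)%N.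
    move=> [f]; rewrite (subdivision_faces KG) => Kf <-.
    rewrite excessE; last exact: subdivision_vertices.
    set N := [fset v in _ | _]%fset.
    have [->|/fset0Pn[v0 v0N]] := eqVneq N fset0; first by rewrite cardfs0.
    have Nnew v : v \in N -> [|| v \in A, v \in B | v \in C] /\ incident v f.
      move=> vN; have /and3P[vV vK /asboolP vf] : [&& v \in vertices G,
          v \notin vertices (K4 R) & `[< incident v f >]] by move: vN; rewrite !inE.
      by split => //; move: vV; rewrite VG 3!in_fsetU -!orbA (negbTE vK).
    have inside v : [|| v \in A, v \in B | v \in C] ->
        [/\ v.1 + v.2 < 1, v.2 < 2 * v.1 + 1 & v.1 < 2 * v.2 + 1].
      by move=> /or3P[/At|/Bt|/Ct] [t /andP[t0 t1] ->] /=; split; lra.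
    have [v0new v0f] := Nnew _ v0N; have [h1 h2 h3] := inside _ v0new.
    have [L iL [fL _]] := incident_inside Kf v0f h1 h2 h3.
    have NL v : v \in N -> [|| v \in A, v \in B | v \in C] /\ closed_tri L v.
      by move=> /Nnew[vn vf]; split => //; apply/(inner_tri_incident _ iL); rewrite -fL.
    have cardU (X Y : {fset plane R}) a b : (#|` X| <= a)%N -> (#|` Y| <= b)%N ->
        (a + b <= k)%N -> {subset N <= (X `|` Y)%fset} -> (#|` N| <= k)%N.
      move=> Xa Yb ab NXY; apply: leq_trans ab.
      apply: (@leq_trans #|` (X `|` Y)%fset|); first exact/fsubset_leq_card/fsubsetP.
      apply: leq_trans (leq_add Xa Yb).
      by rewrite -cardfsUI leq_addr.
    case: (inner_triP iL) => LE; rewrite {}LE in NL.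
    - apply: (cardU _ _ _ _ cA cB kud).
      move=> v /NL[+ Lv]; rewrite in_fsetU => /or3P[->//|->|/Ct[t /andP[t0 t1] vE]].
        by rewrite orbT.
      by move: Lv; rewrite vE => -[]; rewrite /lev /=; lra.
    - apply: (cardU _ _ _ _ cB cC kdd).
      move=> v /NL[+ Lv]; rewrite in_fsetU => /or3P[/At[t /andP[t0 t1] vE]|->//|->].
        by move: Lv; rewrite vE => -[]; rewrite /lev /=; lra.
      by rewrite orbT.
    - apply: (cardU _ _ _ _ cA cC kud).
      move=> v /NL[+ Lv]; rewrite in_fsetU => /or3P[->//|/Bt[t /andP[t0 t1] vE]|->].
        by move: Lv; rewrite vE => -[]; rewrite /lev /=; lra.
      by rewrite orbT.
  have [_ mP] := nat_maxP bd; apply: bd; apply: mP.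
  exists (face_deg G (open_tri (tri_ab R)) - face_deg (K4 R) (open_tri (tri_ab R)))%N.
  exists (open_tri (tri_ab R)) => //.
  by rewrite (subdivision_faces KG); exact: inner_tri_face.
have [mE xE] := sharp_arith low up four mk.
by split => //; exact: K4_k_connected.
Qed.
End Sharpness.

Theorem theorem7 (R : realType) :
  (forall H G : plane_graph R,
     k_connected 3 H -> subdivision H G ->
     chi_c G <= (3 * max_excess H G) %/ 2 + chi_c H)
  /\
  (forall k : nat, exists H G : plane_graph R,
     [/\ k_connected 3 H, subdivision H G, max_excess H G = k &
         chi_c G = (3 * max_excess H G) %/ 2 + chi_c H]).
Proof.
split=> [H G [H3 _]|]; last exact: bound_sharp.
by apply: chi_c_subdivision; exact: leq_trans H3.
Qed.
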